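(* Fix a real number $\theta>0$. For every $m\in\mathbb N$ and every $k\in\mathbb N_0$, $$\lim_{n\to\infty}\mathrm{Leb}\Bigl\{x\in(0,1):\ \#\bigl\{1\le i\le n:\ a_j(x)>(\theta n)^{1/m}\text{ for all } j=i,i+1,\dots,i+m-1\bigr\}=k\Bigr\}=\frac{1}{(\theta\log 2)^k}\,\frac{1}{k!}\,e^{-\frac{1}{\theta\log 2}}.$$ That is, the Lebesgue measure of the set of $x$ for which there are exactly $k$ $m$-tuples $a_ia_{i+1}\cdots a_{i+m-1}$, $1\le i\le n$, all of whose entries are $>(\theta n)^{1/m}$, converges to the displayed limit.
   Context: $\mathbb N=\{1,2,\dots\}$, $\mathbb N_0=\mathbb N\cup\{0\}$. For an irrational $x\in(0,1)$, $x=[a_1,a_2,\dots]$ with $a_i=a_i(x)\in\mathbb N$ denotes its continued fraction expansion, i.e. $x=1/(a_1+1/(a_2+\cdots))$. $\mathrm{Leb}$ is Lebesgue measure on $(0,1)$. *)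

(* Defs.v *)
From mathcomp Require Import all_boot all_order all_algebra.
From mathcomp Require Import all_classical all_reals all_analysis.
Set Implicit Arguments.
Unset Strict Implicit.
Unset Printing Implicit Defensive.
Import Order.TTheory GRing.Theory Num.Theory.
Import numFieldNormedType.Exports.
Local Open Scope classical_set_scope.
Local Open Scope ring_scope.

(* The finite continued fraction [b_1, ..., b_n] = 1/(b_1 + 1/(... + 1/b_n)),
   with the value 0 on the empty list. *)
Fixpoint cf_finite (R : realType) (s : seq nat) : R :=
  if s is b :: s' then (b%:R + cf_finite R s')^-1 else 0.

(* x = [a_1, a_2, ...]. Digits are indexed from 1, and a 0 is unconstrained. *)
Definition is_cf_expansion (R : realType) (x : R) (a : nat -> nat) : Prop :=
  (forall i, (1 <= i)%N -> (1 <= a i)%N) /\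
  cf_finite R [seq a i | i <- iota 1 n] @[n --> \oo] --> x.

(* The digit a_i(x), meaningful for i >= 1 and x irrational in (0,1), where the
   expansion exists and determines it; the value is arbitrary otherwise. *)
Definition cf_digit (R : realType) (x : R) (i : nat) : nat :=
  xget (fun=> 0%N) [set a | is_cf_expansion x a] i.

(* The number of i in {1, ..., n} with a_j(x) > t for j = i, ..., i + m - 1. *)
Definition num_large_tuples (R : realType) (m n : nat) (t x : R) : nat :=
  count (fun i => all (fun j => t < (cf_digit x j)%:R) (iota i m)) (iota 1 n).

(* Main.v *)
(* Under Lebesgue measure the ratio s_n = q_{n-1} / q_n of consecutive continuants
   is a Markov chain: given a cylinder with ratio s, the next digit is a with
   probability (1 + s) / ((a + s) (a + 1 + s)), and s becomes 1 / (a + s).  So the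
   probability of any event on finitely many digits is an iterated series.
   Given s, a run of m digits above t has probability about (1 + s) / t^m.  The
   transfer operator reverses monotonicity and halves the oscillation, hence sends
   1 + s exponentially fast to a constant, which is 1 / ln 2 because the densities
   (U^r (1 + s)) / (1 + s) of the iterated Gauss map have total mass 1.  Thus with
   t^m = theta n a run starts at a given place with conditional probability about
   p = 1 / (theta n ln 2), while two runs within a bounded distance cost m + 1 large
   digits, which is o(1 / n).  A telescoping (Lindeberg) comparison, exchanging one
   place at a time for an independent coin of bias p, then shows that the number of
   runs is close to binomial (n, p), hence to Poisson. *)

Require Import Defs.
From mathcomp Require Import all_boot all_order all_algebra.
From mathcomp Require Import all_classical all_reals all_analysis.
From mathcomp Require Import ring lra zify.
Set Implicit Arguments.
Unset Strict Implicit.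
Unset Printing Implicit Defensive.
Import Order.TTheory GRing.Theory Num.Theory.
Import numFieldNormedType.Exports.
Local Open Scope classical_set_scope.
Local Open Scope ring_scope.

(** * The chain of digits *)

Section digit_law.
Context {R : realType}.
Implicit Types (s : R) (f g : nat -> R).

(** Boundedness makes the series behind [digit_mean] converge for [s >= 0], so that its [limn] is a
    true limit and not a default value. *)
Definition bounded_fun_on {T : Type} (f : T -> R) : Prop :=
  exists K : R, forall a, `|f a| <= K.

Lemma bounded_fun_onP {T : Type} (f : T -> R) :
  bounded_fun_on f -> exists2 K : R, 0 <= K & forall a, `|f a| <= K.
Proof.
move=> [K fK]; exists `|K| => // a; exact: le_trans (fK a) (ler_norm _).
Qed.

Lemma bounded_fun_on_cst {T : Type} (c : R) : bounded_fun_on (fun _ : T => c).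
Proof. by exists `|c|. Qed.

Lemma bounded_fun_onD {T : Type} (f g : T -> R) :
  bounded_fun_on f -> bounded_fun_on g -> bounded_fun_on (fun a => f a + g a).
Proof.
move=> [K fK] [L gL]; exists (K + L) => a.
by rewrite (le_trans (ler_normD _ _))// lerD.
Qed.

Lemma bounded_fun_onM {T : Type} (f g : T -> R) :
  bounded_fun_on f -> bounded_fun_on g -> bounded_fun_on (fun a => f a * g a).
Proof.
move=> [K fK] [L gL]; exists (K * L) => a.
by rewrite normrM ler_pM.
Qed.

Lemma bounded_fun_onZ {T : Type} (c : R) (f : T -> R) :
  bounded_fun_on f -> bounded_fun_on (fun a => c * f a).
Proof. by apply: bounded_fun_onM; exact: bounded_fun_on_cst. Qed.

Lemma bounded_fun_onN {T : Type} (f : T -> R) :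
  bounded_fun_on f -> bounded_fun_on (fun a => - f a).
Proof. by move=> [K fK]; exists K => a; rewrite normrN. Qed.

Lemma bounded_fun_onB {T : Type} (f g : T -> R) :
  bounded_fun_on f -> bounded_fun_on g -> bounded_fun_on (fun a => f a - g a).
Proof. by move=> bf bg; apply: bounded_fun_onD => //; exact: bounded_fun_onN. Qed.

Lemma bounded_fun_on_bool {T : Type} (b : T -> bool) :
  bounded_fun_on (fun a => (b a)%:R).
Proof. by exists 1 => a; case: (b a); rewrite ?normr1 ?normr0. Qed.

(* The conditional probability that the next digit is [a.+1], given a cylinder
   whose last two continuants have ratio [s = q_{n-1} / q_n]. *)
Definition digit_prob s (a : nat) : R :=
  (1 + s) / ((a.+1%:R + s) * (a.+2%:R + s)).

Definition digit_mean s f : R := limn (series (fun a => digit_prob s a * f a)).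

Lemma digit_prob_ge0 s a : 0 <= s -> 0 <= digit_prob s a.
Proof.
by move=> s0; rewrite /digit_prob divr_ge0//; [|apply: mulr_ge0]; exact: addr_ge0.
Qed.

(** Telescoping: [digit_prob s a] is [1 + s] times [(a.+1%:R + s)^-1 - (a.+2%:R + s)^-1]. *)
Lemma sum_digit_prob s n : 0 <= s ->
  \sum_(0 <= a < n) digit_prob s a = n%:R / (n.+1%:R + s).
Proof.
move=> s0; elim: n => [|n IH]; first by rewrite big_nil mul0r.
have n0 : 0 <= n%:R :> R by [].
rewrite big_nat_recr//= IH /digit_prob -!natr1; field.
by apply/andP; split; apply: lt0r_neq0; lra.
Qed.

Lemma sum_digit_prob_le1 s n : 0 <= s -> \sum_(0 <= a < n) digit_prob s a <= 1.
Proof.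
move=> s0; rewrite sum_digit_prob// ler_pdivrMr ?mul1r -?natr1; last first.
  by rewrite -addrA ltr_wpDl// ltr_wpDr.
by rewrite -addrA lerDl addr_ge0.
Qed.

Lemma cvg_digit_mean s f : 0 <= s -> bounded_fun_on f ->
  series (fun a => digit_prob s a * f a) @ \oo --> digit_mean s f.
Proof.
move=> s0 /bounded_fun_onP[K K0 fK]; apply: normed_cvg.
apply: (@series_le_cvg _ _ (fun a => digit_prob s a * K)).
- by move=> a; exact: normr_ge0.
- by move=> a /=; rewrite mulr_ge0 ?digit_prob_ge0.
- move=> a; rewrite /= normrM ger0_norm ?digit_prob_ge0//.
  by rewrite ler_wpM2l ?digit_prob_ge0.
- apply: nondecreasing_is_cvgn.
    by apply: nondecreasing_series => a _ _; rewrite mulr_ge0 ?digit_prob_ge0.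
  exists K => _ [n _ <-]; rewrite /series/= -mulr_suml.
  by rewrite -[leRHS]mul1r ler_wpM2r// sum_digit_prob_le1.
Qed.

Lemma digit_mean_cst s c : 0 <= s -> digit_mean s (fun=> c) = c.
Proof.
move=> s0; apply: (cvg_unique _ (cvg_digit_mean s0 (bounded_fun_on_cst c))) => //.
have -> : series (fun a => digit_prob s a * c) =
    (fun n => c - c * (1 + s) * (n%:R + (1 + s))^-1).
  apply/funext => n; rewrite /series/= -mulr_suml sum_digit_prob// -natr1.
  have n0 : 0 <= n%:R :> R by [].
  by field; apply: lt0r_neq0; lra.
suff : c - c * (1 + s) * (n%:R + (1 + s))^-1 @[n --> \oo] -->
    c - c * (1 + s) * 0 by rewrite mulr0 subr0.
apply: cvgB; first exact: cvg_cst.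
apply: cvgM; first exact: cvg_cst.
apply/gtr0_cvgV0; first by apply: nearW => n; rewrite ltr_wpDl// ltr_wpDr.
exact: (cvg_comp _ _ cvgr_idn (@cvg_addrr _ (1 + s))).
Qed.

Lemma digit_meanD s f g : 0 <= s -> bounded_fun_on f -> bounded_fun_on g ->
  digit_mean s (fun a => f a + g a) = digit_mean s f + digit_mean s g.
Proof.
move=> s0 bf bg.
apply: (cvg_unique _ (cvg_digit_mean s0 (bounded_fun_onD bf bg))) => //.
have -> : series (fun a => digit_prob s a * (f a + g a)) =
    (fun n => series (fun a => digit_prob s a * f a) n +
              series (fun a => digit_prob s a * g a) n).
  apply/funext => n; rewrite /series/= -big_split/=.
  by apply: eq_bigr => a _; rewrite mulrDr.
by apply: cvgD; exact: cvg_digit_mean.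
Qed.

Lemma digit_meanZ s c f : 0 <= s -> bounded_fun_on f ->
  digit_mean s (fun a => c * f a) = c * digit_mean s f.
Proof.
move=> s0 bf.
apply: (cvg_unique _ (cvg_digit_mean s0 (bounded_fun_onZ c bf))) => //.
have -> : series (fun a => digit_prob s a * (c * f a)) =
    (fun n => c * series (fun a => digit_prob s a * f a) n).
  apply/funext => n; rewrite /series/= mulr_sumr.
  by apply: eq_bigr => a _; rewrite mulrCA.
by apply: cvgM; [exact: cvg_cst|exact: cvg_digit_mean].
Qed.

Lemma ler_digit_mean_of_series s s' f g : 0 <= s -> 0 <= s' ->
  bounded_fun_on f -> bounded_fun_on g ->
  (forall n, \sum_(0 <= a < n) digit_prob s a * f a <=
             \sum_(0 <= a < n) digit_prob s' a * g a) ->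
  digit_mean s f <= digit_mean s' g.
Proof.
move=> s0 s'0 bf bg fg.
apply: (ler_cvg_to (cvg_digit_mean s0 bf) (cvg_digit_mean s'0 bg)).
by apply: nearW => n; exact: fg.
Qed.

Lemma ler_digit_mean s f g : 0 <= s -> bounded_fun_on f -> bounded_fun_on g ->
  (forall a, f a <= g a) -> digit_mean s f <= digit_mean s g.
Proof.
move=> s0 bf bg fg; apply: ler_digit_mean_of_series => // n.
by apply: ler_sum => a _; rewrite ler_wpM2l ?digit_prob_ge0.
Qed.

Lemma digit_mean_tail s n : 0 <= s ->
  digit_mean s (fun a => (n <= a)%:R) = (1 + s) / (n.+1%:R + s).
Proof.
move=> s0.
apply: (cvg_unique _ (cvg_digit_mean s0 (bounded_fun_on_bool (leq n)))) => //.
have n0 : 0 <= n%:R :> R by [].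
have -> : (1 + s) / (n.+1%:R + s) =
    digit_mean s (fun=> 1) - \sum_(0 <= a < n) digit_prob s a.
  rewrite digit_mean_cst// sum_digit_prob// -natr1; field.
  by apply: lt0r_neq0; lra.
apply: (@cvg_trans _ ((series (fun a => digit_prob s a * 1) k -
    \sum_(0 <= a < n) digit_prob s a) @[k --> \oo])); last first.
  apply: cvgB; last exact: cvg_cst.
  exact: (cvg_digit_mean s0 (bounded_fun_on_cst 1)).
apply: near_eq_cvg; near=> k.
have nk : (n <= k)%N by near: k; exact: nbhs_infty_ge.
rewrite /series/= (big_cat_nat (n := n))//= [in RHS](big_cat_nat (n := n))//=.
rewrite (eq_big_nat _ _ (F2 := digit_prob s)); last by move=> *; rewrite mulr1.
rewrite [X in _ = X + _]big_nat_cond [X in _ = X + _]big1 ?add0r.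
  rewrite addrAC subrr add0r; apply: eq_big_nat => a /andP[na _].
  by rewrite na.
by move=> a /andP[/andP[_ an] _]; rewrite leqNgt an mulr0.
Unshelve. all: by end_near. Qed.

End digit_law.

(** * The transfer operator on monotone functions *)

Section transfer.
Context {R : realType}.
Implicit Types (s x y t : R) (f F Phi : R -> R).

Definition incr01 f : Prop :=
  forall x y, 0 <= x -> x <= y -> y <= 1 -> f x <= f y.

(** Conditional expectation of [f] at the next ratio, given the ratio [s]. This is the transfer
    operator of the Gauss map for Lebesgue measure, conjugated by the factor [1 + s]. *)
Definition transfer f s : R := digit_mean s (fun a => f (a.+1%:R + s)^-1).

Lemma inv_digit_itv s a : 0 <= s -> 0 <= (a.+1%:R + s)^-1 <= 1.
Proof.
move=> s0; have a1 : 1 <= a.+1%:R :> R by rewrite ler1n.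
rewrite invr_ge0 invf_le1; last by lra.
by apply/andP; split; lra.
Qed.

Lemma bounded_transfer f s (K : R) : (forall x, 0 <= x <= 1 -> `|f x| <= K) ->
  0 <= s -> bounded_fun_on (fun a : nat => f (a.+1%:R + s)^-1).
Proof. by move=> fK s0; exists K => a; apply: fK; exact: inv_digit_itv. Qed.

Lemma incr01_bounded f : incr01 f ->
  exists K : R, forall x, 0 <= x <= 1 -> `|f x| <= K.
Proof.
move=> f01; exists (`|f 0| + `|f 1|) => x /andP[x0 x1].
have := f01 _ _ (lexx 0) x0 x1; have := f01 _ _ x0 x1 (lexx 1).
rewrite ler_norml => h1 h2; have := ler_norm (f 1); have := ler_norm (- f 0).
by rewrite normrN; have := normr_ge0 (f 0); have := normr_ge0 (f 1); lra.
Qed.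

Lemma incr01_bounded_transfer f s : incr01 f -> 0 <= s ->
  bounded_fun_on (fun a : nat => f (a.+1%:R + s)^-1).
Proof. by move=> /incr01_bounded[K fK]; exact: bounded_transfer fK. Qed.

(* Summation by parts, keeping the boundary term. *)
Lemma abel_ler (u v f : nat -> R) n :
  (forall k, \sum_(0 <= a < k) u a <= \sum_(0 <= a < k) v a) ->
  (forall a, f a.+1 <= f a) ->
  \sum_(0 <= a < n) u a * f a +
    (\sum_(0 <= a < n) v a - \sum_(0 <= a < n) u a) * f n <=
  \sum_(0 <= a < n) v a * f a.
Proof.
move=> uv fd; elim: n => [|n IH]; first by rewrite !big_nil subrr mul0r addr0.
have := uv n.+1; have := fd n; move: IH; rewrite !big_nat_recr//=.
set U := \sum_(_ <= _ < _) u _; set V := \sum_(_ <= _ < _) v _.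
set Uf := \sum_(_ <= _ < _) u _ * _; set Vf := \sum_(_ <= _ < _) v _ * _.
(* One more term raises the right side minus the left side by the new excess of the [v] mass over
   the [u] mass times the drop of [f], a product of nonnegative factors. *)
by move=> IH fn UV; nra.
Qed.

(* Stochastic domination: two families of weights with the same total mass. *)
Lemma abel_lim (u v f : nat -> R) (c lu lv : R) :
  (forall k, \sum_(0 <= a < k) u a <= \sum_(0 <= a < k) v a) ->
  (forall a, f a.+1 <= f a) -> bounded_fun_on f ->
  series u @ \oo --> c -> series v @ \oo --> c ->
  series (fun a => u a * f a) @ \oo --> lu ->
  series (fun a => v a * f a) @ \oo --> lv ->
  lu <= lv.
Proof.
move=> uv fd bf uc vc ufl vfl.
have d0 : (series v n - series u n) * f n @[n --> \oo] --> 0.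
  have [K K0 fK] := bounded_fun_onP bf.
  have dK : (series v n - series u n) * K @[n --> \oo] --> 0.
    suff : (series v n - series u n) * K @[n --> \oo] --> (c - c) * K.
      by rewrite subrr mul0r.
    by apply: cvgM; [exact: cvgB|exact: cvg_cst].
  have dNK : - ((series v n - series u n) * K) @[n --> \oo] --> 0.
    by rewrite -oppr0; exact: cvgN.
  apply: (squeeze_cvgr _ dNK dK); apply: nearW => n.
  have d : 0 <= series v n - series u n by rewrite subr_ge0; exact: uv.
  have := fK n; rewrite ler_norml => /andP[f1 f2].
  by rewrite -mulrN !ler_wpM2l.
have ufl' : series (fun a => u a * f a) n +
    (series v n - series u n) * f n @[n --> \oo] --> lu.
  by rewrite -[lu]addr0; exact: cvgD.
apply: (ler_cvg_to ufl' vfl).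
by apply: nearW => n; exact: abel_ler.
Qed.

Lemma cvg_sum_digit_prob s : 0 <= s -> series (digit_prob s) @ \oo --> (1 : R).
Proof.
move=> s0; have := cvg_digit_mean s0 (bounded_fun_on_cst (1 : R)).
rewrite digit_mean_cst//.
by under eq_fun do rewrite mulr1.
Qed.

Lemma incr01_digit f s : incr01 f -> 0 <= s -> forall a : nat,
  f (a.+2%:R + s)^-1 <= f (a.+1%:R + s)^-1.
Proof.
move=> f01 s0 a; have /andP[_ h1] := inv_digit_itv a s0.
have /andP[h2 _] := inv_digit_itv a.+1 s0.
apply: f01 => //; have a1 : 1 <= a.+1%:R :> R by rewrite ler1n.
by rewrite -[a.+2%:R]natr1 lef_pV2 ?posrE; lra.
Qed.

(** Two effects act in the same direction when the ratio grows: every point [(a.+1%:R + s)^-1] moves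
    down, and the digit law shifts towards larger digits, hence towards smaller points. The
    intermediate term mixes the law at [y] with the points at [x]. *)
Lemma incr01_transfer f : incr01 f -> incr01 (fun s => - transfer f s).
Proof.
move=> f01 x y x0 xy y1; rewrite lerN2; have y0 := le_trans x0 xy.
apply: (@le_trans _ _ (digit_mean y (fun a => f (a.+1%:R + x)^-1))).
  apply: ler_digit_mean => //; try exact: incr01_bounded_transfer.
  move=> a; have /andP[_ h1] := inv_digit_itv a x0.
  have /andP[h2 _] := inv_digit_itv a y0.
  apply: f01 => //; have a1 : 1 <= a.+1%:R :> R by rewrite ler1n.
  by rewrite lef_pV2 ?posrE; lra.
have bf := incr01_bounded_transfer f01 x0.
apply: (abel_lim _ (incr01_digit f01 x0) bf (cvg_sum_digit_prob y0)
  (cvg_sum_digit_prob x0) (cvg_digit_mean y0 bf) (cvg_digit_mean x0 bf)).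
move=> k; rewrite !sum_digit_prob// ler_wpM2l//.
have k1 : 1 <= k.+1%:R :> R by rewrite ler1n.
by rewrite lef_pV2 ?posrE; lra.
Qed.

(** From ratio 0 the first digit is 1 with probability one half; otherwise the remaining digits,
    lowered by one, follow exactly the law of ratio 1 and lead to the same points. This identity is
    the source of the contraction factor. *)
Lemma transfer0 f : incr01 f -> transfer f 0 = 2^-1 * (f 1 + transfer f 1).
Proof.
move=> f01.
have b0 := incr01_bounded_transfer f01 (lexx 0).
have b1 := incr01_bounded_transfer f01 ler01.
apply: (cvg_unique _ (cvg_digit_mean (lexx 0) b0)) => //.
set u := series _.
suff : u n.+1 @[n --> \oo] --> 2^-1 * (f 1 + transfer f 1) by rewrite cvg_shiftS.
have -> : (fun n => u n.+1) = (fun n => 2^-1 * (f 1 +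
    series (fun a => digit_prob 1 a * f (a.+1%:R + 1)^-1) n)).
  apply/funext => n.
  rewrite /u /series/= big_nat_recl//= mulrDr mulr_sumr; congr (_ + _).
    rewrite /digit_prob !addr0 invr1; congr (_ * _).
    by rewrite !mul1r.
  apply: eq_bigr => a _; rewrite mulrA natr1 addr0; congr (_ * _).
  rewrite /digit_prob !addr0 !natr1.
  have a0 : 0 <= a%:R :> R by [].
  rewrite -[a.+3%:R]natr1 -[a.+2%:R]natr1 -[a.+1%:R]natr1; field.
  by apply/andP; split; apply: lt0r_neq0; lra.
apply: cvgM; first exact: cvg_cst.
by apply: cvgD; [exact: cvg_cst|exact: cvg_digit_mean].
Qed.

Lemma transfer_ge f s (m : R) : incr01 f -> 0 <= s ->
  (forall x, 0 <= x <= 1 -> m <= f x) -> m <= transfer f s.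
Proof.
move=> f01 s0 fm; rewrite -(digit_mean_cst m s0).
apply: ler_digit_mean => //; first exact: bounded_fun_on_cst.
  exact: incr01_bounded_transfer.
by move=> a; apply: fm; exact: inv_digit_itv.
Qed.

Lemma transfer_osc f : incr01 f ->
  - transfer f 1 - (- transfer f 0) <= 2^-1 * (f 1 - f 0).
Proof.
move=> f01; rewrite (transfer0 f01).
have : f 0 <= transfer f 1; last by lra.
apply: transfer_ge => // x /andP[x0 x1]; exact: f01.
Qed.

End transfer.

(** * The Gauss-Kuzmin-Levy theorem for the density at the origin *)

Section gauss_kuzmin.
Context {R : realType}.
Implicit Types (s x y t : R) (F Phi : R -> R).

(** Concavity of [ln] on the chord from 1 to [w]: both ends lie below the tangent at the
    intermediate point [z], and the linear terms average to zero. *)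
Lemma ln_chord t w : 0 <= t -> t <= 1 -> 0 < w ->
  t * ln w <= ln (1 + t * (w - 1)) :> R.
Proof.
move=> t0 t1 w0; set z := 1 + _.
have z0 : 0 < z by rewrite /z; nra.
have tangent v : 0 < v -> ln v <= ln z + (v / z - 1).
  move=> v0; have vz : 0 < v / z by rewrite divr_gt0.
  have := @le_ln1Dx R (v / z - 1); rewrite addrCA subrr addr0 ln_div ?posrE//.
  by move=> h; have := h _; rewrite lerBlDl; apply; lra.
have := tangent _ w0; have := tangent _ ltr01; rewrite ln1 => h1 h2.
have h3 : t * (w / z - 1) + (1 - t) * (1 / z - 1) = 0.
  by rewrite /z; field; apply: lt0r_neq0.
by nra.
Qed.

(* The mass that the measure with density [1 / (1 + u)] gives to the interval
   between [1 / (a + 1 + y)] and [1 / (a + 1 + x)]. *)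
Definition gauss_gap x y (a : nat) : R :=
  ln (1 + (a.+1%:R + x)^-1) - ln (1 + (a.+1%:R + y)^-1).

Lemma sum_gauss_gap x y n : 0 <= x -> 0 <= y ->
  \sum_(0 <= a < n) gauss_gap x y a =
  ln (1 + y) - ln (1 + x) - (ln (n.+1%:R + y) - ln (n.+1%:R + x)).
Proof.
move=> x0 y0; elim: n => [|n IH]; first by rewrite big_nil subrr.
rewrite big_nat_recr//= IH /gauss_gap.
have n1 : 1 <= n.+1%:R :> R by rewrite ler1n.
have n0 : 0 <= n%:R :> R by [].
have lnE (z : R) : 0 <= z -> ln (1 + (n.+1%:R + z)^-1) =
    ln (n.+2%:R + z) - ln (n.+1%:R + z).
  move=> z0; rewrite -ln_div ?posrE; [|exact: ltr_wpDr..].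
  by congr ln; rewrite -[n.+2%:R]natr1; field; apply: lt0r_neq0; lra.
by rewrite !lnE//; lra.
Qed.

Lemma gauss_gap_ge0 x y a : 0 <= x -> x <= y -> 0 <= gauss_gap x y a.
Proof.
move=> x0 xy; have a1 : 1 <= a.+1%:R :> R by rewrite ler1n.
have y' : 0 < (a.+1%:R + y)^-1 by rewrite invr_gt0; lra.
have x' : (a.+1%:R + y)^-1 <= (a.+1%:R + x)^-1.
  by rewrite lef_pV2 ?posrE; lra.
by rewrite /gauss_gap subr_ge0 ler_ln ?posrE; lra.
Qed.

Section compare.
Variables (x y : R).

Local Notation ell := (ln (1 + y) - ln (1 + x)).

(** With the next lemma: the Gauss masses of the preimages of the interval from [x] to [y] are
    stochastically between the digit laws at [x] and at [y], scaled to mass [ell]. After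
    telescoping, each bound is [ln_chord] at a point where [1 + t * (w - 1)] is a quotient of
    [n.+1%:R + x] and [n.+1%:R + y]. *)
Lemma sum_gauss_gap_le n : 0 <= x -> x <= y ->
  \sum_(0 <= a < n) gauss_gap x y a <=
  \sum_(0 <= a < n) digit_prob x a * ell.
Proof.
move=> x0 xy; have n0 : 0 <= n%:R :> R by [].
rewrite sum_gauss_gap; [|lra..]; rewrite -mulr_suml sum_digit_prob//.
have := @ln_chord ((1 + x) / (n.+1%:R + x)) ((1 + y) / (1 + x)).
rewrite -natr1 ln_div ?posrE; [|lra..]; move=> h.
have -> : n%:R / (n%:R + 1 + x) * ell = ell - (1 + x) / (n%:R + 1 + x) * ell.
  by field; apply: lt0r_neq0; lra.
rewrite lerB// -[leRHS]ln_div ?posrE; [|lra..].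
rewrite (le_trans (h _ _ _))//.
- by rewrite divr_ge0; lra.
- by rewrite ler_pdivrMr; lra.
- by rewrite divr_gt0; lra.
rewrite le_eqVlt; apply/orP; left; apply/eqP; congr ln; field.
by apply/andP; split; apply: lt0r_neq0; lra.
Qed.

Lemma sum_gauss_gap_ge n : 0 <= x -> x <= y ->
  \sum_(0 <= a < n) digit_prob y a * ell <=
  \sum_(0 <= a < n) gauss_gap x y a.
Proof.
move=> x0 xy; have n0 : 0 <= n%:R :> R by [].
have y0 : 0 <= y by lra.
rewrite sum_gauss_gap//; rewrite -mulr_suml sum_digit_prob//.
have := @ln_chord ((1 + y) / (n.+1%:R + y)) ((1 + x) / (1 + y)).
rewrite -natr1 ln_div ?posrE; [|lra..].
have -> : ln (1 + x) - ln (1 + y) = - ell by lra.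
move=> h.
have -> : n%:R / (n%:R + 1 + y) * ell = ell - (1 + y) / (n%:R + 1 + y) * ell.
  by field; apply: lt0r_neq0; lra.
rewrite lerB// -lerN2 opprB -mulrN -[leRHS]ln_div ?posrE; [|lra..].
rewrite (le_trans (h _ _ _))//.
- by rewrite divr_ge0; lra.
- by rewrite ler_pdivrMr; lra.
- by rewrite divr_gt0; lra.
rewrite le_eqVlt; apply/orP; left; apply/eqP; congr ln; field.
by apply/andP; split; apply: lt0r_neq0; lra.
Qed.

Lemma cvg_digit_prob_mass s : 0 <= s ->
  series (fun a => digit_prob s a * ell) @ \oo --> ell.
Proof.
move=> s0; have := cvg_digit_mean s0 (bounded_fun_on_cst ell).
by rewrite digit_mean_cst.
Qed.

(** Invariance of the Gauss measure: the branch preimages of an interval carry together the mass of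
    the interval. *)
Lemma cvg_gauss_gap : 0 <= x -> x <= y -> series (gauss_gap x y) @ \oo --> ell.
Proof.
move=> x0 xy; have y0 : 0 <= y by lra.
apply: (squeeze_cvgr _ (cvg_digit_prob_mass y0) (cvg_digit_prob_mass x0)).
apply: nearW => n; apply/andP; split; first exact: sum_gauss_gap_ge.
exact: sum_gauss_gap_le.
Qed.

End compare.

(* [Phi] is, up to monotonicity of [F], a primitive of [F u / (1 + u)]. *)
Definition gauss_primitive F Phi : Prop :=
  forall x y, 0 <= x -> x <= y -> y <= 1 ->
  F x * (ln (1 + y) - ln (1 + x)) <= Phi y - Phi x <=
  F y * (ln (1 + y) - ln (1 + x)).

Section step.
Variables F Phi : R -> R.
Hypotheses (F01 : incr01 F) (FPhi : gauss_primitive F Phi).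

Let gap x y (a : nat) := Phi (a.+1%:R + x)^-1 - Phi (a.+1%:R + y)^-1.

Let gap_bounds x y a : 0 <= x -> x <= y ->
  F (a.+1%:R + y)^-1 * gauss_gap x y a <= gap x y a <=
  F (a.+1%:R + x)^-1 * gauss_gap x y a.
Proof.
move=> x0 xy; have y0 : 0 <= y by lra.
have a1 : 1 <= a.+1%:R :> R by rewrite ler1n.
have /andP[y'0 _] := inv_digit_itv a y0.
have /andP[_ x'1] := inv_digit_itv a x0.
by apply: FPhi => //; rewrite lef_pV2 ?posrE; lra.
Qed.

Let is_cvg_gap x y : 0 <= x -> x <= y -> cvgn (series (gap x y)).
Proof.
move=> x0 xy; have y0 : 0 <= y by lra.
have [K FK] := incr01_bounded F01.
have K0 : 0 <= K by rewrite (le_trans _ (FK 0 _))// lexx ler01.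
apply: normed_cvg.
apply: (@series_le_cvg _ _ (fun a => K * gauss_gap x y a)).
- by move=> a; exact: normr_ge0.
- by move=> a /=; rewrite mulr_ge0// gauss_gap_ge0.
- move=> a /=; have /andP[] := gap_bounds a x0 xy.
  have := gauss_gap_ge0 a x0 xy.
  have := FK _ (inv_digit_itv a x0); have := FK _ (inv_digit_itv a y0).
  rewrite !ler_norml => /andP[? ?] /andP[? ?] g0 g1 g2.
  by apply/andP; split; nra.
- apply: (@is_cvg_seriesZ _ (gauss_gap x y : R^o ^nat) K).
  by apply/cvg_ex; eexists; exact: cvg_gauss_gap.
Qed.

(** Mass conservation without integrals: the increment of [Psi] is minus the sum of the increments
    of [Phi] over all branch preimages. The sign is chosen so that the new density [- transfer F] is
    again increasing. For the whole interval the preimages tile it, and the total mass only changes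
    sign. *)
Lemma gauss_primitive_transfer : exists2 Psi : R -> R,
  gauss_primitive (fun s => - transfer F s) Psi &
  Psi 1 - Psi 0 = - (Phi 1 - Phi 0).
Proof.
pose Psi y := - limn (series (gap 0 y)).
have PsiE x y : 0 <= x -> x <= y ->
    series (gap x y) @ \oo --> - (Psi y - Psi x).
  move=> x0 xy; have y0 : 0 <= y by lra.
  have -> : series (gap x y) = series (gap 0 y) - series (gap 0 x).
    apply/funext => n; rewrite /series/= /GRing.add/= /GRing.opp/= -sumrB.
    by apply: eq_bigr => a _; rewrite /gap; lra.
  have -> : - (Psi y - Psi x) = limn (series (gap 0 y)) - limn (series (gap 0 x)).
    by rewrite /Psi; lra.
  by apply: cvgB; apply: is_cvg_gap.
exists Psi => [x y x0 xy y1|].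
- have y0 : 0 <= y by lra.
  have bF z : 0 <= z -> bounded_fun_on (fun a : nat => F (a.+1%:R + z)^-1).
    exact: incr01_bounded_transfer.
  set ell := _ - _.
  have cT z : 0 <= z -> series (fun a => digit_prob z a * ell * F (a.+1%:R + z)^-1)
      @ \oo --> transfer F z * ell.
    move=> z0; have -> : series (fun a => digit_prob z a * ell * F (a.+1%:R + z)^-1)
        = (fun n => series (fun a => digit_prob z a * F (a.+1%:R + z)^-1) n * ell).
      apply/funext => n; rewrite /series/= mulr_suml.
      by apply: eq_bigr => a _; rewrite mulrAC.
    by apply: cvgM; [exact: cvg_digit_mean (bF _ z0)|exact: cvg_cst].
  have cG z : 0 <= z -> cvgn (series (fun a => gauss_gap x y a * F (a.+1%:R + z)^-1)).
    move=> z0; have [K K0 FK] := bounded_fun_onP (bF _ z0); apply: normed_cvg.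
    apply: (@series_le_cvg _ _ (fun a => K * gauss_gap x y a)).
    + by move=> a; exact: normr_ge0.
    + by move=> a /=; rewrite mulr_ge0// gauss_gap_ge0.
    + move=> a /=; have g0 := gauss_gap_ge0 a x0 xy.
      by rewrite normrM (ger0_norm g0) mulrC ler_wpM2r.
    + apply: (@is_cvg_seriesZ _ (gauss_gap x y : R^o ^nat) K).
      by apply/cvg_ex; eexists; exact: cvg_gauss_gap.
  (* Each increment of [Phi] is bounded through the value of [F] at the right end of its preimage;
     then the Gauss weights are replaced by the digit law at [x], which favours small digits. The
     bound [lo] mirrors this with left ends and the law at [y]. *)
  have up : - (Psi y - Psi x) <= transfer F x * ell.
    apply: (@le_trans _ _
        (limn (series (fun a => gauss_gap x y a * F (a.+1%:R + x)^-1)))).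
      apply: (ler_cvg_to (PsiE _ _ x0 xy) (cG _ x0)); apply: nearW => n.
      apply: ler_sum => a _; rewrite mulrC.
      by have /andP[] := gap_bounds a x0 xy.
    apply: (abel_lim _ (incr01_digit F01 x0) (bF _ x0) _ _ (cG _ x0) (cT _ x0)).
    + by move=> k; exact: sum_gauss_gap_le.
    + exact: cvg_gauss_gap.
    + exact: cvg_digit_prob_mass.
  have lo : transfer F y * ell <= - (Psi y - Psi x).
    apply: (@le_trans _ _
        (limn (series (fun a => gauss_gap x y a * F (a.+1%:R + y)^-1)))); last first.
      apply: (ler_cvg_to (cG _ y0) (PsiE _ _ x0 xy)); apply: nearW => n.
      apply: ler_sum => a _; rewrite mulrC.
      by have /andP[] := gap_bounds a x0 xy.
    apply: (abel_lim _ (incr01_digit F01 y0) (bF _ y0) _ _ (cT _ y0) (cG _ y0)).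
    + by move=> k; exact: sum_gauss_gap_ge.
    + exact: cvg_digit_prob_mass.
    + exact: cvg_gauss_gap.
  by clearbody ell; apply/andP; split; lra.
- suff : - (Psi 1 - Psi 0) = Phi 1 - Phi 0 by move=> <-; rewrite [RHS]opprK.
  have P1 := PsiE 0 1 (lexx 0) ler01.
  apply: (cvg_unique _ P1) => //.
  have -> : series (gap 0 1) = fun n => Phi 1 - Phi (n.+1%:R)^-1.
    apply/funext => n; rewrite /series/=.
    elim: n => [|n IH]; first by rewrite big_nil invr1 subrr.
    rewrite big_nat_recr//= IH /gap addr0 natr1; lra.
  apply: cvgB; first exact: cvg_cst.
  have [K FK] := incr01_bounded F01.
  (* Continuity of [Phi] at 0 follows from [gauss_primitive]: the increment from 0 to [z] is at most
     [K * ln (1 + z)], hence at most [K * z], in absolute value. *)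
  suff c0 : Phi n.+1%:R^-1 - Phi 0 @[n --> \oo] --> (0 : R).
    have -> : (fun n => Phi n.+1%:R^-1) = (fun n => Phi n.+1%:R^-1 - Phi 0 + Phi 0).
      by apply/funext => n; rewrite subrK.
    by rewrite -[X in _ --> X]add0r; apply: cvgD => //; exact: cvg_cst.
  have h0 : K * (n.+1%:R : R)^-1 @[n --> \oo] --> 0.
    rewrite -[X in _ --> X](mulr0 K); apply: cvgM; first exact: cvg_cst.
    exact: cvg_harmonic.
  have hN0 : - (K * (n.+1%:R : R)^-1) @[n --> \oo] --> 0.
    by rewrite -oppr0; exact: cvgN.
  apply: (squeeze_cvgr _ hN0 h0); apply: nearW => n.
  have := inv_digit_itv n (lexx (0 : R)); rewrite addr0 => /andP[n0 n1].
  have /andP[] := FPhi (lexx 0) n0 n1; rewrite addr0 ln1 subr0.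
  have l1 := @le_ln1Dx R n.+1%:R^-1.
  have l2 : 0 <= ln (1 + n.+1%:R^-1 : R) by rewrite ln_ge0// lerDl.
  have {}l1 : ln (1 + n.+1%:R^-1) <= n.+1%:R^-1 :> R.
    by apply: l1; exact: lt_le_trans n0.
  move: n0 n1 l1 l2; set z := n.+1%:R^-1; set l := ln _ => n0 n1 l1 l2 h1 h2.
  have := FK 0; have := FK z; rewrite !ler_norml lexx ler01 n0 n1.
  move=> /(_ isT)/andP[a1 a2] /(_ isT)/andP[b1 b2].
  have K0 : 0 <= K by lra.
  have c1 := ler_wpM2l K0 l1; have c2 := ler_wpM2r l2 a2.
  have c3 := ler_wpM2r l2 b1; rewrite mulNr in c3.
  by apply/andP; split; lra.
Qed.

End step.

(* Each application of [transfer] reverses monotonicity, hence the signs. *)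
Lemma iter_transfer_gauss (r : nat) :
  exists F Phi, [/\ forall s, 0 <= s -> F s = (-1) ^+ r * iter r transfer (+%R 1) s,
    incr01 F, F 1 - F 0 <= 2^-1 ^+ r, gauss_primitive F Phi &
    Phi 1 - Phi 0 = (-1) ^+ r].
Proof.
elim: r => [|r [F [Phi [FE F01 Fosc FPhi Phi1]]]].
  (* For [F s = 1 + s] the quotient [F u / (1 + u)] is 1, so the identity is a primitive; both
     bounds come from [ln (1 + z) <= z] at the two ratios of [1 + x] and [1 + y]. *)
  exists (+%R 1), id; split => //.
  - by move=> s _; rewrite mul1r.
  - by move=> x y _ xy _; rewrite lerD2l.
  - by rewrite expr0; lra.
  - move=> x y x0 xy y1 /=; rewrite -ln_div ?posrE; [|lra..].
    have := @le_ln1Dx R ((1 + y) / (1 + x) - 1).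
    have := @le_ln1Dx R ((1 + x) / (1 + y) - 1).
    have sq (q : R) : 1 + (q - 1) = q by rewrite addrC subrK.
    rewrite !sq -(invf_div (1 + y)) lnV ?posrE ?divr_gt0//; [|lra..].
    rewrite invf_div => h1 h2.
    have {}h1 : - ln ((1 + y) / (1 + x)) <= (1 + x) / (1 + y) - 1.
      by apply: h1; rewrite ltrBrDl subrr divr_gt0; lra.
    have {}h2 : ln ((1 + y) / (1 + x)) <= (1 + y) / (1 + x) - 1.
      by apply: h2; rewrite ltrBrDl subrr divr_gt0; lra.
    have e1 : (1 + y) * ((1 + x) / (1 + y) - 1) = x - y.
      by field; apply: lt0r_neq0; lra.
    have e2 : (1 + x) * ((1 + y) / (1 + x) - 1) = y - x.
      by field; apply: lt0r_neq0; lra.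
    by apply/andP; split; nra.
  - by rewrite subr0.
have [Psi FPsi Psi1] := gauss_primitive_transfer F01 FPhi.
exists (fun s => - transfer F s), Psi; split => //.
- move=> s s0; rewrite exprS mulN1r mulNr /=; congr (- _).
  set G := iter r _ _ in FE *.
  have GE x : 0 <= x -> G x = (-1) ^+ r * F x.
    by move=> x0; rewrite FE// mulrA -expr2 sqrr_sign mul1r.
  have -> : transfer G s = transfer (fun x => (-1) ^+ r * F x) s.
    congr digit_mean; apply/funext => a; apply: GE.
    by have /andP[] := inv_digit_itv a s0.
  rewrite /transfer digit_meanZ//; last exact: incr01_bounded_transfer.
  by rewrite mulrA -expr2 sqrr_sign mul1r.
- exact: incr01_transfer.
- by rewrite (le_trans (transfer_osc F01))// exprS ler_wpM2l.
- by rewrite Psi1 Phi1 exprS mulN1r.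
Qed.

(** Total mass one, up to sign, forces the signed constant [(ln 2)^-1] to lie between [F 0] and
    [F 1]. The value [F s] lies there too, and these ends differ by at most [2^-1 ^+ r]. *)
Lemma gauss_kuzmin_levy r s : 0 <= s <= 1 ->
  `|iter r transfer (+%R 1) s - (ln 2)^-1| <= 2^-1 ^+ r.
Proof.
move=> /andP[s0 s1]; have [F [Phi [FE F01 Fosc FPhi Phi1]]] := iter_transfer_gauss r.
have := FPhi 0 1 (lexx 0) ler01 (lexx 1); rewrite addr0 ln1 subr0 Phi1.
have ln2 : 0 < ln (1 + 1 : R) by rewrite ln_gt0// ltrDl.
move=> /andP[]; rewrite -ler_pdivlMr// => c0; rewrite -ler_pdivrMr// => c1.
have := F01 _ _ (lexx 0) s0 s1; have := F01 _ _ s0 s1 (lexx 1).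
move=> Fs1 F0s; rewrite -(normrMsign r) mulrBr -FE//.
move: c0 c1 Fs1 F0s Fosc; set e := (-1) ^+ r * _; set h := 2^-1 ^+ r.
set X := F s; set Y := F 0; set Z := F 1 => c0 c1 Fs1 F0s Fosc.
by rewrite ler_norml; apply/andP; split; lra.
Qed.

End gauss_kuzmin.

(** * Expectations over words of digits *)

Section words.
Context {R : realType}.
Implicit Types (w u v : seq nat) (phi psi : seq nat -> R) (N : nat).

(* The ratio [q_{n-1} / q_n] of the last two continuants of the digits
   [a.+1], [a] ranging over [w]. *)
Definition ratio w : R := foldl (fun s a => (a.+1%:R + s)^-1) 0 w.

Lemma ratio_rcons w a : ratio (rcons w a) = (a.+1%:R + ratio w)^-1.
Proof. by rewrite /ratio foldl_rcons. Qed.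

Lemma ratio_itv w : 0 <= ratio w <= 1.
Proof.
elim/last_ind: w => [|w a /andP[s0 _]]; first by rewrite /ratio/= lexx ler01.
by rewrite ratio_rcons inv_digit_itv.
Qed.

Lemma ratio_ge0 w : 0 <= ratio w.
Proof. by case/andP: (ratio_itv w). Qed.

(* The conditional expectation of [phi] given the initial word [w], when [N]
   more digits are read. *)
Fixpoint word_mean N w phi : R :=
  if N is N'.+1 then digit_mean (ratio w) (fun a => word_mean N' (rcons w a) phi)
  else phi w.

Lemma word_mean_norm (K : R) N w phi : (forall u, `|phi u| <= K) ->
  `|word_mean N w phi| <= K.
Proof.
move=> phiK; elim: N w => [|N IH] w //=.
have s0 := ratio_ge0 w.
have b : bounded_fun_on (fun a => word_mean N (rcons w a) phi) by exists K.
rewrite ler_norml -{1}(digit_mean_cst (- K) s0) -{2}(digit_mean_cst K s0).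
by apply/andP; split; apply: ler_digit_mean => //;
  try (exact: bounded_fun_on_cst); move=> a;
  have := IH (rcons w a); rewrite ler_norml => /andP[].
Qed.

Lemma bounded_word_mean (T : Type) N (h : T -> seq nat) phi :
  bounded_fun_on phi -> bounded_fun_on (fun a => word_mean N (h a) phi).
Proof. by move=> [K phiK]; exists K => a; exact: word_mean_norm. Qed.

Lemma ler_word_mean N w phi psi : bounded_fun_on phi -> bounded_fun_on psi ->
  (forall v, size v = N -> phi (w ++ v) <= psi (w ++ v)) ->
  word_mean N w phi <= word_mean N w psi.
Proof.
move=> bphi bpsi; elim: N w => [|N IH] w /= le_phi.
  by have := le_phi [::] erefl; rewrite cats0.
apply: ler_digit_mean; [exact: ratio_ge0|exact: bounded_word_mean..|].
move=> a; apply: IH => v vN; rewrite cat_rcons; apply: le_phi.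
by rewrite /= vN.
Qed.

Lemma eq_word_mean N w phi psi :
  (forall v, size v = N -> phi (w ++ v) = psi (w ++ v)) ->
  word_mean N w phi = word_mean N w psi.
Proof.
elim: N w => [|N IH] w /= eq_phi.
  by have := eq_phi [::] erefl; rewrite cats0.
congr digit_mean; apply/funext => a; apply: IH => v vN.
by rewrite cat_rcons; apply: eq_phi; rewrite /= vN.
Qed.

Lemma word_mean_cst N w (c : R) : word_mean N w (fun=> c) = c.
Proof.
elim: N w => [//|N IH] w /=.
under [X in digit_mean _ X]eq_fun do rewrite IH.
by rewrite digit_mean_cst// ratio_ge0.
Qed.

Lemma word_meanD N w phi psi : bounded_fun_on phi -> bounded_fun_on psi ->
  word_mean N w (fun u => phi u + psi u) = word_mean N w phi + word_mean N w psi.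
Proof.
move=> bphi bpsi; elim: N w => [//|N IH] w /=.
under [X in digit_mean _ X]eq_fun do rewrite IH.
by rewrite digit_meanD//; [exact: ratio_ge0|exact: bounded_word_mean..].
Qed.

Lemma word_meanZ N w (c : R) phi : bounded_fun_on phi ->
  word_mean N w (fun u => c * phi u) = c * word_mean N w phi.
Proof.
move=> bphi; elim: N w => [//|N IH] w /=.
under [X in digit_mean _ X]eq_fun do rewrite IH.
by rewrite digit_meanZ//; [exact: ratio_ge0|exact: bounded_word_mean].
Qed.

Lemma word_meanB N w phi psi : bounded_fun_on phi -> bounded_fun_on psi ->
  word_mean N w (fun u => phi u - psi u) = word_mean N w phi - word_mean N w psi.
Proof.
move=> bphi bpsi; rewrite -mulN1r -word_meanZ// -word_meanD//; last first.
  exact: bounded_fun_onZ.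
by apply: eq_word_mean => v _; rewrite mulN1r.
Qed.

Lemma bounded_fun_on_sum (T : Type) (n : nat) (F : nat -> T -> R) :
  (forall i, bounded_fun_on (F i)) ->
  bounded_fun_on (fun a => \sum_(0 <= i < n) F i a).
Proof.
move=> bF; elim: n => [|n IH].
  by exists 0 => a; rewrite big_nil normr0.
have [K FK] := bounded_fun_onD IH (bF n); exists K => a.
by rewrite big_nat_recr//=; exact: FK.
Qed.

Lemma word_mean_sum N w (n : nat) (F : nat -> seq nat -> R) :
  (forall i, bounded_fun_on (F i)) ->
  word_mean N w (fun u => \sum_(0 <= i < n) F i u) =
  \sum_(0 <= i < n) word_mean N w (F i).
Proof.
move=> bF; elim: n => [|n IH].
  rewrite big_nil -[RHS](word_mean_cst N w 0).
  by apply: eq_word_mean => v _; rewrite big_nil.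
rewrite big_nat_recr//= -IH -word_meanD//; last exact: bounded_fun_on_sum.
by apply: eq_word_mean => v _; rewrite big_nat_recr.
Qed.

Lemma ler_norm_word_mean N w phi psi :
  bounded_fun_on phi -> bounded_fun_on psi ->
  (forall v, size v = N -> `|phi (w ++ v)| <= psi (w ++ v)) ->
  `|word_mean N w phi| <= word_mean N w psi.
Proof.
move=> bphi bpsi le_phi; rewrite ler_norml; apply/andP; split.
  rewrite -mulN1r -word_meanZ//; apply: ler_word_mean => //.
    exact: bounded_fun_onZ.
  by move=> v /le_phi; rewrite mulN1r ler_norml => /andP[].
by apply: ler_word_mean => // v /le_phi; rewrite ler_norml => /andP[].
Qed.

Lemma word_mean_add N M w phi :
  word_mean (N + M) w phi = word_mean N w (fun u => word_mean M u phi).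
Proof.
elim: N w => [//|N IH] w /=.
by congr digit_mean; apply/funext => a; exact: IH.
Qed.

Lemma word_mean_prefix L N phi : (L <= N)%N ->
  (forall u v, size u = L -> phi (u ++ v) = phi u) ->
  word_mean N [::] phi = word_mean L [::] phi.
Proof.
move=> LN phiE; rewrite -(subnKC LN) word_mean_add; apply: eq_word_mean => u uL.
rewrite -[RHS](word_mean_cst (N - L) u); apply: eq_word_mean => v _.
by rewrite phiE.
Qed.

(** The next ratio depends on the word only through its present ratio, so the ratios form a Markov
    chain with transition operator [transfer]. *)
Lemma word_mean_ratio r w (f : R -> R) :
  word_mean r w (fun u => f (ratio u)) = iter r transfer f (ratio w).
Proof.
elim: r w => [//|r IH] w /=; congr digit_mean; apply/funext => a.
by rewrite IH ratio_rcons.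
Qed.

End words.

(** * The probability of a run of large digits *)

Section runs.
Context {R : realType}.
Implicit Types (w u v : seq nat) (s : R) (tau m i j : nat).

(* Letters are counted from [0], and a letter [a] stands for the digit [a.+1]. *)
Definition occ tau m i u : bool :=
  all (fun j => tau <= nth 0 u j)%N (iota i m).

Lemma occ_cat tau m i u v : (i + m <= size u)%N ->
  occ tau m i (u ++ v) = occ tau m i u.
Proof.
move=> im; apply: eq_in_all => j; rewrite mem_iota => /andP[_ jm].
by rewrite nth_cat (leq_trans jm im).
Qed.

Fixpoint run_prob tau m s : R :=
  if m is m'.+1 then
    digit_mean s (fun a => (tau <= a)%N%:R * run_prob tau m' (a.+1%:R + s)^-1)
  else 1.

Lemma run_prob_itv tau m s : 0 <= s -> 0 <= run_prob tau m s <= 1.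
Proof.
elim: m s => [|m IH] s s0 /=; first by rewrite ler01 lexx.
have b : bounded_fun_on
    (fun a => (tau <= a)%N%:R * run_prob tau m (a.+1%:R + s)^-1).
  apply: bounded_fun_onM; first exact: bounded_fun_on_bool.
  exists 1 => a; have /andP[a0 _] := inv_digit_itv a s0.
  by have /andP[h0 h1] := IH _ a0; rewrite ger0_norm.
apply/andP; split.
- rewrite -[leLHS](digit_mean_cst 0 s0); apply: ler_digit_mean => //.
    exact: bounded_fun_on_cst.
  move=> a; have /andP[a0 _] := inv_digit_itv a s0.
  by have /andP[h0 h1] := IH _ a0; rewrite mulr_ge0.
- rewrite -[leRHS](digit_mean_cst 1 s0); apply: ler_digit_mean => //.
    exact: bounded_fun_on_cst.
  move=> a; have /andP[a0 _] := inv_digit_itv a s0.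
  have /andP[h0 h1] := IH _ a0.
  by case: (_ <= _)%N; rewrite ?mul1r ?mul0r.
Qed.

Lemma bounded_run_prob tau m s : 0 <= s -> bounded_fun_on
  (fun a => (tau <= a)%N%:R * run_prob tau m (a.+1%:R + s)^-1).
Proof.
move=> s0; apply: bounded_fun_onM; first exact: bounded_fun_on_bool.
exists 1 => a; have /andP[a0 _] := inv_digit_itv a s0.
by have /andP[h0 h1] := run_prob_itv tau m a0; rewrite ger0_norm.
Qed.

Lemma word_mean_occ tau m w :
  word_mean m w (fun u => (occ tau m (size w) u)%:R) = run_prob tau m (ratio w).
Proof.
elim: m w => [//|m IH] w /=; congr digit_mean; apply/funext => a.
rewrite -ratio_rcons -IH -word_meanZ; last exact: bounded_fun_on_bool.
apply: eq_word_mean => v _; rewrite /occ /= size_rcons -mulnb natrM.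
by rewrite nth_cat size_rcons ltnSn nth_rcons ltnn eqxx.
Qed.

Lemma run_prob_ge tau m s : 0 <= s <= 1 ->
  (tau.+2%:R ^-1) ^+ m <= run_prob tau m s.
Proof.
elim: m s => [|m IH] s /andP[s0 s1]; first by rewrite expr0.
have t1 : 1 <= tau.+1%:R :> R by rewrite ler1n.
have q0 : 0 <= (tau.+2%:R ^-1 : R) ^+ m by rewrite exprn_ge0.
have h : (tau.+2%:R ^-1) ^+ m * ((1 + s) / (tau.+1%:R + s)) <= run_prob tau m.+1 s.
  rewrite -digit_mean_tail// -digit_meanZ//; last exact: bounded_fun_on_bool.
  apply: ler_digit_mean => //.
  - by apply: bounded_fun_onZ; exact: bounded_fun_on_bool.
  - exact: bounded_run_prob.
  - by move=> a; rewrite mulrC ler_wpM2l// IH// inv_digit_itv.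
apply: le_trans h; rewrite exprSr ler_wpM2l//.
rewrite ler_pdivlMr; last by lra.
by rewrite ler_pdivrMl -?[tau.+2%:R]natr1; nra.
Qed.

(** The factor [1 + s] is kept for the first digit only; each later digit is given its worst-case
    lower bound. *)
Lemma run_probS_ge tau m s : 0 <= s <= 1 ->
  (1 + s) * (tau.+2%:R ^-1) ^+ m.+1 <= run_prob tau m.+1 s.
Proof.
move=> /andP[s0 s1].
have t1 : 1 <= tau.+1%:R :> R by rewrite ler1n.
have q0 : 0 <= (tau.+2%:R ^-1 : R) ^+ m by rewrite exprn_ge0.
have h : (tau.+2%:R ^-1) ^+ m * ((1 + s) / (tau.+1%:R + s)) <= run_prob tau m.+1 s.
  rewrite -digit_mean_tail// -digit_meanZ//; last exact: bounded_fun_on_bool.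
  apply: ler_digit_mean => //.
  - by apply: bounded_fun_onZ; exact: bounded_fun_on_bool.
  - exact: bounded_run_prob.
  - by move=> a; rewrite mulrC ler_wpM2l// run_prob_ge// inv_digit_itv.
apply: le_trans h; rewrite exprSr mulrCA ler_wpM2l// ler_wpM2l//; first by lra.
by rewrite lef_pV2 ?posrE -?[tau.+2%:R]natr1; lra.
Qed.

(** Once a large digit has been read, the ratio is at most [tau.+1%:R^-1]; so the bound [C] on the
    rest of the run is required only on that short range. *)
Lemma run_probS_le tau m s (C : R) : 0 <= s ->
  (forall x, 0 <= x <= tau.+1%:R ^-1 -> run_prob tau m x <= C) ->
  run_prob tau m.+1 s <= C * ((1 + s) / (tau.+1%:R + s)).
Proof.
move=> s0 leC; rewrite -digit_mean_tail// -digit_meanZ//; last first.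
  exact: bounded_fun_on_bool.
apply: ler_digit_mean => //.
- exact: bounded_run_prob.
- by apply: bounded_fun_onZ; exact: bounded_fun_on_bool.
- move=> a; case: leqP => [ta|_]; last by rewrite mul0r mulr0.
  rewrite mul1r mulr1; apply: leC.
  have /andP[-> _] := inv_digit_itv a s0.
  have : tau.+1%:R <= a.+1%:R :> R by rewrite ler_nat.
  have t1 : 0 < tau.+1%:R :> R by [].
  by move=> h; rewrite lef_pV2 ?posrE; lra.
Qed.

Lemma run_prob_le tau m s : 0 <= s <= tau.+1%:R ^-1 ->
  run_prob tau m s <= ((1 + tau.+1%:R ^-1) * tau.+1%:R ^-1) ^+ m.
Proof.
elim: m s => [|m IH] s /andP[s0 s1]; first by rewrite expr0.
apply: le_trans (run_probS_le s0 IH) _; rewrite exprSr.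
have t1 : 1 <= tau.+1%:R :> R by rewrite ler1n.
have t0 : 0 <= tau.+1%:R^-1 :> R by rewrite invr_ge0; lra.
rewrite ler_wpM2l//.
apply: ler_pM; [lra|rewrite invr_ge0; lra|by rewrite lerD2l|].
by rewrite lef_pV2 ?posrE; lra.
Qed.

Lemma run_probS_le_pow tau m s : 0 <= s ->
  run_prob tau m.+1 s <=
  (1 + s) * (tau.+1%:R ^-1 * ((1 + tau.+1%:R ^-1) * tau.+1%:R ^-1) ^+ m).
Proof.
move=> s0; apply: le_trans (run_probS_le s0 (@run_prob_le tau m)) _.
have t1 : 1 <= tau.+1%:R :> R by rewrite ler1n.
have t0 : 0 <= tau.+1%:R^-1 :> R by rewrite invr_ge0; lra.
rewrite mulrC -mulrA ler_wpM2l//; first by lra.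
rewrite ler_wpM2r//.
by rewrite lef_pV2 ?posrE; lra.
Qed.

(** A bound uniform in the past, with [1 + s] replaced by 2; it serves the error terms, where
    constants are harmless. *)
Lemma run_prob_crude tau m s : 0 <= s <= 1 ->
  run_prob tau m s <= (2 * tau.+1%:R ^-1) ^+ m.
Proof.
elim: m s => [|m IH] s /andP[s0 s1]; first by rewrite expr0.
have t1 : 1 <= tau.+1%:R :> R by rewrite ler1n.
have t0 : 0 <= tau.+1%:R^-1 :> R by rewrite invr_ge0; lra.
have ti : tau.+1%:R^-1 <= 1 :> R by rewrite invf_le1.
have h x : 0 <= x <= tau.+1%:R ^-1 -> run_prob tau m x <= (2 * tau.+1%:R ^-1) ^+ m.
  by move=> /andP[x0 x1]; apply: IH; rewrite x0 (le_trans x1).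
apply: le_trans (run_probS_le s0 h) _; rewrite exprSr.
rewrite ler_wpM2l//.
apply: ler_pM; [lra|rewrite invr_ge0; lra|lra|].
by rewrite lef_pV2 ?posrE; lra.
Qed.

Lemma word_mean_occ1_le tau m i N : (i + m <= N)%N ->
  word_mean N [::] (fun u => (occ tau m i u)%:R) <= (2 * tau.+1%:R ^-1) ^+ m :> R.
Proof.
move=> imN; rewrite (word_mean_prefix imN); last first.
  by move=> u v uim; rewrite occ_cat// uim.
rewrite word_mean_add -[leRHS](word_mean_cst i [::]).
apply: ler_word_mean; [|exact: bounded_fun_on_cst|].
  by apply: bounded_word_mean; exact: bounded_fun_on_bool.
move=> v <-; rewrite word_mean_occ run_prob_crude//.
exact: ratio_itv.
Qed.

(** Of the run at [j] only the last digit is used: it comes after the whole run at [i], so it costs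
    one further factor given everything read before it. *)
Lemma word_mean_occ2_le tau m i j N : (0 < m)%N -> (i < j)%N -> (j + m <= N)%N ->
  word_mean N [::] (fun u => (occ tau m i u && occ tau m j u)%:R)
    <= (2 * tau.+1%:R ^-1) ^+ m.+1 :> R.
Proof.
case: m => [//|m] _ ij jmN; rewrite (word_mean_prefix jmN); last first.
  by move=> u v ujm; rewrite !occ_cat ?ujm// leq_add2r ltnW.
rewrite addnS -addn1 word_mean_add exprSr.
have c0 : 0 <= 2 * tau.+1%:R ^-1 :> R by rewrite mulr_ge0.
have im : (i + m.+1 <= j + m)%N by rewrite addnS -addSn leq_add2r.
apply: (@le_trans _ _ (word_mean (j + m) [::]
    (fun u => (2 * tau.+1%:R ^-1) * (occ tau m.+1 i u)%:R))); last first.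
  rewrite word_meanZ; last exact: bounded_fun_on_bool.
  by rewrite mulrC ler_wpM2r// word_mean_occ1_le.
apply: ler_word_mean.
- by apply: bounded_word_mean; exact: bounded_fun_on_bool.
- by apply: bounded_fun_onZ; exact: bounded_fun_on_bool.
move=> w wjm; rewrite cat0s.
apply: (@le_trans _ _ (word_mean 1 w
    (fun u => (occ tau m.+1 i w)%:R * (occ tau 1 (size w) u)%:R))).
  apply: ler_word_mean; [exact: bounded_fun_on_bool| |].
    by apply: bounded_fun_onZ; exact: bounded_fun_on_bool.
  move=> v v1; rewrite occ_cat ?wjm// -natrM mulnb ler_nat.
  have : occ tau m.+1 j (w ++ v) -> occ tau 1 (size w) (w ++ v).
    by rewrite /occ -addn1 iotaD all_cat wjm => /andP[].
  rewrite wjm.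
  by case: (occ _ _ i _); case: (occ _ _ j _) => // /(_ isT) ->.
rewrite word_meanZ; last exact: bounded_fun_on_bool.
rewrite word_mean_occ mulrC ler_wpM2r//.
by rewrite -[leRHS]expr1 run_prob_crude// ratio_itv.
Qed.

End runs.

(** * Comparison with the binomial distribution *)

Section lindeberg.
Context {R : realType}.
Implicit Types (w u v : seq nat) (p : R) (i j k c n : nat).

(* The probability that [c] plus a binomial variable of parameters [j] and [p]
   equals [k]. *)
Fixpoint binom_hit p k j c : R :=
  if j is j'.+1 then (1 - p) * binom_hit p k j' c + p * binom_hit p k j' c.+1
  else (c == k)%:R.

Lemma binom_hit_itv p k j c : 0 <= p <= 1 -> 0 <= binom_hit p k j c <= 1.
Proof.
move=> /andP[p0 p1]; elim: j c => [|j IH] c /=.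
  by case: (c == k); rewrite ?ler01 lexx.
have /andP[a0 a1] := IH c; have /andP[b0 b1] := IH c.+1.
by apply/andP; split; nra.
Qed.

Definition binom_jump p k j c : R := binom_hit p k j c.+1 - binom_hit p k j c.

Lemma binom_jump_norm p k j c : 0 <= p <= 1 -> `|binom_jump p k j c| <= 1.
Proof.
move=> p01; have /andP[a0 a1] := binom_hit_itv k j c p01.
have /andP[b0 b1] := binom_hit_itv k j c.+1 p01.
by rewrite ler_norml; apply/andP; split; rewrite /binom_jump; lra.
Qed.

Lemma sum_ltn_le n l : (\sum_(0 <= i < n) (i < l) <= l)%N.
Proof.
have : (\sum_(0 <= i < n) (i < l) <= minn n l)%N.
  elim: n => [|n IH]; first by rewrite big_nil.
  by rewrite big_nat_recr//=; lia.
by move=> h; rewrite (leq_trans h)// geq_minr.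
Qed.

Section counting.
Variables tau m : nat.
Hypothesis m_gt0 : (0 < m)%N.

Definition nb_occ n u : nat := \sum_(0 <= i < n) occ tau m i u.

Lemma nb_occS n u : nb_occ n.+1 u = (nb_occ n u + occ tau m n u)%N.
Proof. by rewrite /nb_occ big_nat_recr. Qed.

(** The last of the [n] places is [n - 1], whose run ends at index [n + m - 2]; hence the successor
    in the bound. *)
Lemma nb_occ_cat n u v : (n + m <= (size u).+1)%N ->
  nb_occ n (u ++ v) = nb_occ n u.
Proof.
move=> nu; apply: eq_big_nat => i /andP[_ ni]; rewrite occ_cat//.
by rewrite -ltnS (leq_trans _ nu)// -addSn leq_add2r.
Qed.

Lemma nb_occ_eq i j u : (i <= j)%N ->
  ~~ has (fun l => occ tau m l u) (index_iota i j) -> nb_occ j u = nb_occ i u.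
Proof.
move=> ij /hasPn no; rewrite /nb_occ (big_cat_nat (n := i))//=.
rewrite [X in (_ + X)%N]big_nat_cond [X in (_ + X)%N]big1 ?addn0// => l.
rewrite andbT => lij; case: (boolP (occ _ _ _ _)) => // ol.
by have := no l; rewrite mem_index_iota lij ol => /(_ isT).
Qed.

(** Lindeberg hybrids, for a fixed word: the [i]-th one counts actual runs at the places below [i]
    and tosses coins at the remaining [n - i]. Exchanging one coin for a run changes it by the
    centred indicator times the effect of one more success. *)
Lemma binom_telescope p k n u :
  binom_hit p k 0 (nb_occ n u) - binom_hit p k n 0 =
  \sum_(0 <= i < n) ((occ tau m i u)%:R - p) * binom_jump p k (n - i.+1) (nb_occ i u).
Proof.
have step i : (i < n)%N ->
    binom_hit p k (n - i.+1) (nb_occ i.+1 u) - binom_hit p k (n - i) (nb_occ i u) =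
    ((occ tau m i u)%:R - p) * binom_jump p k (n - i.+1) (nb_occ i u).
  move=> i_n; rewrite -(subnSK i_n)/= nb_occS /binom_jump.
  by case: (occ _ _ _ _); rewrite ?addn1 ?addn0 /=; lra.
transitivity (\sum_(0 <= i < n)
    (binom_hit p k (n - i.+1) (nb_occ i.+1 u) - binom_hit p k (n - i) (nb_occ i u))).
  rewrite (@telescope_sumr _ 0 n (fun i => binom_hit p k (n - i) (nb_occ i u)))//.
  have nb0 : nb_occ 0 u = 0%N by rewrite /nb_occ big_geq.
  by rewrite subnn subn0 nb0.
by apply: eq_big_nat => i /andP[_ i_n]; exact: step.
Qed.

Section bound.
Variables (p delta : R) (k r n N : nat).
Hypotheses (p01 : 0 <= p <= 1) (nmN : (n + m <= N)%N).
(** The iterate is the conditional probability, given [w], that a run starts after [r] further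
    letters. *)
Hypothesis mixing : forall w,
  `|iter r transfer (run_prob tau m) (ratio w) - p| <= delta.

Let q : R := 2 * tau.+1%:R^-1.

Let term i u : R :=
  ((occ tau m i u)%:R - p) * binom_jump p k (n - i.+1) (nb_occ i u).

Let bounded_jump j (h : seq nat -> nat) :
  bounded_fun_on (fun u => binom_jump p k j (h u)).
Proof. by exists 1 => u; exact: binom_jump_norm. Qed.

Let bounded_occ i : bounded_fun_on (fun u => (occ tau m i u)%:R - p).
Proof.
apply: bounded_fun_onB; last exact: bounded_fun_on_cst.
exact: bounded_fun_on_bool.
Qed.

Let bounded_term i : bounded_fun_on (term i).
Proof. by apply: bounded_fun_onM; [exact: bounded_occ|exact: bounded_jump]. Qed.

Let norm_occ i u : `|(occ tau m i u)%:R - p| <= (occ tau m i u)%:R + p.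
Proof.
move: p01 => /andP[p0 p1].
by rewrite ler_norml; case: (occ _ _ _ _) => /=; apply/andP; split; lra.
Qed.

(** No cancellation is exploited: this serves the first [r + m] places, which leave no room for
    mixing. *)
Let early i : (i < n)%N -> `|word_mean N [::] (term i)| <= q ^+ m + p.
Proof.
move=> i_n; apply: (@le_trans _ _
    (word_mean N [::] (fun u => (occ tau m i u)%:R + p))).
  apply: ler_norm_word_mean => //.
    by apply: bounded_fun_onD; [exact: bounded_fun_on_bool|exact: bounded_fun_on_cst].
  move=> v _; rewrite normrM -[leRHS]mulr1.
  by apply: ler_pM => //; exact: binom_jump_norm.
rewrite word_meanD; [|exact: bounded_fun_on_bool|exact: bounded_fun_on_cst].
rewrite word_mean_cst lerD2r word_mean_occ1_le//.
by rewrite (leq_trans _ nmN)// leq_add2r ltnW.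
Qed.

(* The count up to [i] is traded for the count up to [i - (r + m)], which leaves
   [r] digits for mixing before the run at [i] is read. *)
Let far i u : term i u =
  ((occ tau m i u)%:R - p) * (binom_jump p k (n - i.+1) (nb_occ i u) -
     binom_jump p k (n - i.+1) (nb_occ (i - (r + m)) u)) +
  binom_jump p k (n - i.+1) (nb_occ (i - (r + m)) u) * ((occ tau m i u)%:R - p).
Proof. by rewrite /term; lra. Qed.

(** The two counts differ only if a run starts among the [r + m] places before [i]. Together with a
    run at [i] this has probability at most [q ^+ m.+1], and paired with the coin it weighs
    [p * q ^+ m]; the factor 2 bounds a difference of two jumps. *)
Let near_part i : (i < n)%N -> (r + m <= i)%N ->
  `|word_mean N [::] (fun u => ((occ tau m i u)%:R - p) *
     (binom_jump p k (n - i.+1) (nb_occ i u) -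
      binom_jump p k (n - i.+1) (nb_occ (i - (r + m)) u)))|
  <= 2 * (r + m)%:R * (q ^+ m.+1 + p * q ^+ m).
Proof.
move=> i_n rmi; set i0 := (i - (r + m))%N.
pose pairs u : R := \sum_(i0 <= j < i)
  2 * ((occ tau m j u && occ tau m i u)%:R + p * (occ tau m j u)%:R).
have pairsE : pairs = (fun u => \sum_(0 <= j < r + m) 2 *
    ((occ tau m (j + i0) u && occ tau m i u)%:R + p * (occ tau m (j + i0) u)%:R)).
  apply/funext => u.
  by rewrite /pairs -{1}[i0]add0n big_addn /i0 subKn.
have bpair j : bounded_fun_on (fun u => 2 * ((occ tau m (j + i0) u &&
    occ tau m i u)%:R + p * (occ tau m (j + i0) u)%:R)).
  apply: bounded_fun_onZ; apply: bounded_fun_onD; first exact: bounded_fun_on_bool.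
  by apply: bounded_fun_onZ; exact: bounded_fun_on_bool.
have /andP[p0 p1] := p01.
apply: (@le_trans _ _ (word_mean N [::] pairs)).
  apply: ler_norm_word_mean.
  - by apply: bounded_fun_onM; [exact: bounded_occ|apply: bounded_fun_onB].
  - by rewrite pairsE; exact: bounded_fun_on_sum.
  - move=> u _; rewrite cat0s /pairs; have i0i : (i0 <= i)%N by exact: leq_subr.
    case: (boolP (has (fun l => occ tau m l u) (index_iota i0 i))) => [|no]; last first.
      rewrite (nb_occ_eq i0i no) subrr mulr0 normr0 sumr_ge0// => j _.
      by rewrite mulr_ge0// addr_ge0// mulr_ge0.
    move=> /hasP[l]; rewrite mem_index_iota => lij ol.
    rewrite (bigD1_seq l)/= ?mem_index_iota ?iota_uniq//.
    rewrite ol mulr1 andTb normrM mulrC.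
    rewrite -[leLHS]addr0; apply: lerD; last first.
      by rewrite sumr_ge0// => j _; rewrite mulr_ge0// addr_ge0// mulr_ge0.
    apply: ler_pM => //; apply: le_trans (ler_normB _ _) _.
    rewrite (_ : 2 = 1 + 1)//; apply: lerD; exact: binom_jump_norm.
rewrite pairsE word_mean_sum//.
apply: (@le_trans _ _ (\sum_(0 <= j < r + m) 2 * (q ^+ m.+1 + p * q ^+ m))).
  apply: ler_sum_nat => j /andP[_ jr].
  have ji : (j + i0 < i)%N by rewrite /i0; lia.
  have imN : (i + m <= N)%N by rewrite (leq_trans _ nmN)// leq_add2r ltnW.
  rewrite word_meanZ; last first.
    apply: bounded_fun_onD; first exact: bounded_fun_on_bool.
    by apply: bounded_fun_onZ; exact: bounded_fun_on_bool.
  rewrite ler_wpM2l// word_meanD; [|exact: bounded_fun_on_bool|]; last first.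
    by apply: bounded_fun_onZ; exact: bounded_fun_on_bool.
  apply: lerD; first exact: word_mean_occ2_le.
  rewrite word_meanZ; last exact: bounded_fun_on_bool.
  rewrite ler_wpM2l// word_mean_occ1_le//.
  by rewrite (leq_trans _ imN)// leq_add2r ltnW.
by rewrite sumr_const_nat subn0 -[leLHS]mulr_natl mulrA [X in X * _]mulrC.
Qed.

(** The jump is already determined by the first [i0 + m] letters and factors out of the conditional
    expectation. The next [r] letters then bring the probability of a run at [i] within [delta] of
    [p]. *)
Let far_part i : (i < n)%N -> (r + m <= i)%N ->
  `|word_mean N [::] (fun u => binom_jump p k (n - i.+1) (nb_occ (i - (r + m)) u) *
     ((occ tau m i u)%:R - p))| <= delta.
Proof.
move=> i_n rmi; set i0 := (i - (r + m))%N.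
have imN : (i + m <= N)%N by rewrite (leq_trans _ nmN)// leq_add2r ltnW.
rewrite (@word_mean_prefix _ (i + m)%N)//; last first.
  move=> u v uim; rewrite occ_cat ?uim// nb_occ_cat// uim.
  by rewrite ltnW// ltnS leq_add2r leq_subr.
have iE : (i = (i0 + m) + r)%N by rewrite /i0 -addnA [(m + r)%N]addnC subnK.
rewrite [in X in word_mean X]iE -addnA word_mean_add.
rewrite -[leRHS](word_mean_cst (i0 + m) [::]).
apply: ler_norm_word_mean; [|exact: bounded_fun_on_cst|].
  by apply: bounded_word_mean; apply: bounded_fun_onM.
move=> w wi0; rewrite cat0s in wi0 *.
have -> : word_mean (r + m) w (fun u => binom_jump p k (n - i.+1) (nb_occ i0 u) *
     ((occ tau m i u)%:R - p)) = binom_jump p k (n - i.+1) (nb_occ i0 w) *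
     word_mean (r + m) w (fun u => (occ tau m i u)%:R - p).
  rewrite -word_meanZ//; apply: eq_word_mean => v _.
  by rewrite nb_occ_cat// wi0 leqnSn.
rewrite normrM -[leRHS]mul1r ler_pM//; first exact: binom_jump_norm.
rewrite word_meanB; [|exact: bounded_fun_on_bool|exact: bounded_fun_on_cst].
rewrite word_mean_cst word_mean_add.
rewrite (@eq_word_mean _ _ _ _ (fun u => run_prob tau m (ratio u))); last first.
  by move=> v vr; rewrite -word_mean_occ size_cat wi0 vr -iE.
rewrite word_mean_ratio; exact: mixing.
Qed.

Lemma word_mean_nb_occ :
  `|word_mean N [::] (fun u => (nb_occ n u == k)%:R) - binom_hit p k n 0| <=
  (r + m)%:R * (q ^+ m + p) +
  n%:R * (2 * (r + m)%:R * (q ^+ m.+1 + p * q ^+ m) + delta).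
Proof.
have -> : word_mean N [::] (fun u => (nb_occ n u == k)%:R) - binom_hit p k n 0 =
    \sum_(0 <= i < n) word_mean N [::] (term i).
  rewrite -word_mean_sum// -[X in _ - X](word_mean_cst N [::]) -word_meanB.
  - by apply: eq_word_mean => u _; exact: binom_telescope.
  - exact: bounded_fun_on_bool.
  - exact: bounded_fun_on_cst.
have /andP[p0 p1] := p01.
have q0 : 0 <= q by rewrite mulr_ge0.
have delta0 : 0 <= delta by exact: le_trans (mixing [::]).
set A := q ^+ m + p; set B := _ * (_ + _ * _).
have A0 : 0 <= A by rewrite addr_ge0// exprn_ge0.
have B0 : 0 <= B by rewrite /B !mulr_ge0// addr_ge0 ?mulr_ge0 ?exprn_ge0.
apply: le_trans (ler_norm_sum _ _ _) _.
apply: (@le_trans _ _ (\sum_(0 <= i < n) ((i < r + m)%N%:R * A + (B + delta)))).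
  apply: ler_sum_nat => i /andP[_ i_n]; case: ltnP => rmi.
    by rewrite mul1r (le_trans (early i_n))// lerDl addr_ge0.
  rewrite mul0r add0r (funext (far i)) word_meanD//; first last.
  - exact: bounded_fun_onM.
  - by apply: bounded_fun_onM => //; exact: bounded_fun_onB.
  apply: le_trans (ler_normD _ _) _.
  by apply: lerD; [exact: near_part|exact: far_part].
rewrite big_split/= -mulr_suml sumr_const_nat subn0 -[_ *+ n]mulr_natl lerD2r.
rewrite ler_wpM2r// -natr_sum ler_nat.
exact: sum_ltn_le.
Qed.

End bound.
End counting.
End lindeberg.

(** * The Poisson limit of the binomial distribution *)

Section poisson_limit.
Context {R : realType}.

Lemma cvg_invn : (n%:R : R)^-1 @[n --> \oo] --> 0.
Proof.
apply/gtr0_cvgV0; last exact: cvgr_idn.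
by near=> n; rewrite ltr0n; near: n; exact: nbhs_infty_gt.
Unshelve. all: by end_near. Qed.

Lemma binom_hit_gt (p : R) k n c : (k < c)%N -> binom_hit p k n c = 0.
Proof.
elim: n c => [|n IH] c kc /=; first by rewrite gtn_eqF.
by rewrite !IH ?mulr0 ?addr0// ltnW.
Qed.

(** With the target written as [c + l], a success lowers [l] by one, and the recursion becomes the
    rule of Pascal. *)
Lemma binom_hitE (p : R) n c l :
  binom_hit p (c + l) n c = 'C(n, l)%:R * p ^+ l * (1 - p) ^+ (n - l).
Proof.
elim: n c l => [|n IH] c [|l] /=.
- by rewrite addn0 eqxx bin0 !expr0 !mulr1.
- by rewrite bin0n -[X in X == _]addn0 eqn_add2l !mul0r.
- rewrite IH binom_hit_gt ?addn0//= mulr0 addr0 !bin0 !expr0 !mulr1 !mul1r !subn0.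
  by rewrite exprS.
- rewrite IH addnS -addSn IH binS natrD subSS !exprS.
  have [ln|nl] := ltnP l n.
    by rewrite -(subnSK ln) !exprS; ring.
  by rewrite bin_small ?ltnS// !mul0r mulr0 !add0r; ring.
Qed.

Lemma cvg_ffact_pow k : (n ^_ k)%:R * (n%:R^-1) ^+ k @[n --> \oo] --> (1 : R).
Proof.
elim: k => [|k IH].
  have -> : (fun n => (n ^_ 0)%:R * (n%:R^-1) ^+ 0) = fun=> 1 :> R.
    by apply/funext => n; rewrite ffactn0 expr0 mulr1.
  exact: cvg_cst.
have h : (n ^_ k)%:R * (n%:R^-1) ^+ k * (1 - k%:R * n%:R^-1) @[n --> \oo] -->
    (1 * (1 - k%:R * 0) : R).
  apply: cvgM => //; apply: cvgB; first exact: cvg_cst.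
  by apply: cvgM; [exact: cvg_cst|exact: cvg_invn].
rewrite mulr0 subr0 mulr1 in h; apply: cvg_trans h; apply: near_eq_cvg.
near=> n; have kn : (k <= n)%N by near: n; exact: nbhs_infty_ge.
have n0 : (0 < n)%N by near: n; exact: nbhs_infty_gt.
rewrite ffactnSr natrM natrB// exprSr; field.
by rewrite pnatr_eq0 -lt0n.
Unshelve. all: by end_near. Qed.

(** With [x = lam / n], the inequality [1 + y <= expR y] is used twice: at [- x] for the upper
    bound, and at [x / (1 - x)], inverted, for the lower bound. *)
Lemma cvg_exp_lim (lam : R) : 0 <= lam ->
  (1 - lam * n%:R^-1) ^+ n @[n --> \oo] --> expR (- lam).
Proof.
move=> lam0.
have hx : lam * n%:R^-1 @[n --> \oo] --> 0.
  by rewrite -[X in _ --> X](mulr0 lam); apply: cvgM; [exact: cvg_cst|exact: cvg_invn].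
have h : expR (- (lam * (1 - lam * n%:R^-1)^-1)) @[n --> \oo] -->
    expR (- (lam * (1 - 0)^-1)).
  apply: continuous_cvg; first exact: continuous_expR.
  apply: cvgN; apply: cvgM; first exact: cvg_cst.
  apply: cvgV; first by rewrite subr0 oner_neq0.
  by apply: cvgB => //; exact: cvg_cst.
rewrite subr0 invr1 mulr1 in h.
apply: (squeeze_cvgr _ h (cvg_cst _)).
near=> n.
have n0 : 0 < n%:R :> R by rewrite ltr0n; near: n; exact: nbhs_infty_gt.
have x1 : lam * n%:R^-1 < 1.
  by near: n; apply: (cvgr_lt _ hx); exact: ltr01.
set x := lam * n%:R^-1 in x1 *.
have x0 : 0 <= x by rewrite mulr_ge0// invr_ge0 ltW.
have y0 : 0 < 1 - x by lra.
have lamE : lam = n%:R * x by rewrite /x mulrCA divff ?mulr1// lt0r_neq0.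
clearbody x; apply/andP; split; last first.
  rewrite lamE -mulrN expRM_natl lerXn2r ?nnegrE ?expR_ge0//; first by lra.
  exact: expR_ge1Dx.
rewrite {1}lamE -mulrA -mulrN expRM_natl lerXn2r ?nnegrE ?expR_ge0//; first by lra.
rewrite expRN -[leRHS]invrK lef_pV2 ?posrE ?expR_gt0 ?invr_gt0//.
apply: le_trans (expR_ge1Dx _).
rewrite le_eqVlt; apply/orP; left; apply/eqP; field.
exact: lt0r_neq0.
Unshelve. all: by end_near. Qed.

Lemma poisson_limit (lam : R) k : 0 <= lam ->
  binom_hit (lam * n%:R^-1) k n 0 @[n --> \oo] -->
  lam ^+ k * (1 / k`!%:R) * expR (- lam).
Proof.
move=> lam0.
have hx : lam * n%:R^-1 @[n --> \oo] --> 0.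
  by rewrite -[X in _ --> X](mulr0 lam); apply: cvgM; [exact: cvg_cst|exact: cvg_invn].
have h : lam ^+ k * (1 / k`!%:R) * ((n ^_ k)%:R * (n%:R^-1) ^+ k) *
    (1 - lam * n%:R^-1) ^+ n * (((1 - lam * n%:R^-1) ^+ k)^-1) @[n --> \oo] -->
    lam ^+ k * (1 / k`!%:R) * 1 * expR (- lam) * (((1 - 0) ^+ k)^-1).
  apply: cvgM; last first.
    apply: cvgV; first by rewrite subr0 expr1n oner_neq0.
    apply: (@continuous_cvg _ _ _ _ _ _ (fun x : R => x ^+ k)).
      exact: exprn_continuous.
    by apply: cvgB => //; exact: cvg_cst.
  apply: cvgM; last exact: cvg_exp_lim.
  by apply: cvgM; [exact: cvg_cst|exact: cvg_ffact_pow].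
rewrite subr0 expr1n invr1 !mulr1 in h.
apply: cvg_trans h; apply: near_eq_cvg; near=> n.
have x1 : lam * n%:R^-1 < 1.
  by near: n; apply: (cvgr_lt _ hx); exact: ltr01.
have kn : (k <= n)%N by near: n; exact: nbhs_infty_ge.
have /= := binom_hitE (lam * n%:R^-1) n 0 k; rewrite add0n => ->.
have nE : (1 - lam * n%:R^-1) ^+ n =
    (1 - lam * n%:R^-1) ^+ (n - k) * (1 - lam * n%:R^-1) ^+ k.
  by rewrite -exprD subnK.
have y0 : (1 - lam * n%:R^-1) ^+ k != 0.
  by rewrite expf_neq0//; apply: lt0r_neq0; lra.
rewrite -bin_ffact natrM exprMn {}nE; move: y0.
set y := _ ^+ k => y0; set z := _ ^+ (n - k); set v := _ ^+ k; set l := _ ^+ k.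
field.
by rewrite y0 pnatr_eq0 -lt0n fact_gt0.
Unshelve. all: by end_near. Qed.

End poisson_limit.

(** * Asymptotics at the threshold whose [m]-th power is [theta * n] *)

Section asymptotics.
Context {R : realType}.

Lemma run_prob_sandwich (t s : R) m : 0 < t -> 0 <= s <= 1 -> (0 < m)%N ->
  (1 + s) * (t ^- m * ((1 + 2 * t^-1)^-1) ^+ m) <= run_prob (Num.trunc t) m s
    <= (1 + s) * (t ^- m * (1 + t^-1) ^+ m).
Proof.
case: m => [//|m] t0 /andP[s0 s1] _.
have /andP[tl tu] := truncn_itv (ltW t0); set tau := Num.trunc t in tl tu *.
have t'0 : 0 < t^-1 by rewrite invr_gt0.
have q0 : 0 < tau.+1%:R^-1 :> R by rewrite invr_gt0.
have qt : tau.+1%:R^-1 <= t^-1 by rewrite lef_pV2 ?posrE// ltW.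
apply/andP; split.
  apply: le_trans (run_probS_ge tau m _); last by rewrite s0.
  rewrite ler_wpM2l//; first by lra.
  rewrite -exprVn -exprMn lerXn2r ?nnegrE ?invr_ge0//.
    by rewrite mulr_ge0 ?invr_ge0//; lra.
  rewrite -invfM lef_pV2 ?posrE//; last by rewrite mulr_gt0//; lra.
  have -> : t * (1 + 2 * t^-1) = t + 2 by field; exact: lt0r_neq0.
  by rewrite -[tau.+2%:R]natr1 -natr1; lra.
apply: le_trans (run_probS_le_pow tau m s0) _; rewrite ler_wpM2l//; first by lra.
rewrite -exprVn -exprMn exprS.
set x := tau.+1%:R^-1 in q0 qt *; set y := t^-1 in t'0 qt *.
have xy : (1 + x) * x <= y * (1 + y) by nra.
apply: ler_pM; [lra|by rewrite exprn_ge0// mulr_ge0; lra|by nra|].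
by rewrite lerXn2r// nnegrE mulr_ge0; lra.
Qed.

(** Iterates of [transfer] are expectations, so they preserve the sandwich of [run_prob] between
    multiples of [1 + s], and [gauss_kuzmin_levy] evaluates the iterates of [1 + s]. The factor
    [(ln 2)^-1 + 1] bounds such an iterate. *)
Lemma mixing_rate (t : R) m r w : 0 < t -> (0 < m)%N ->
  `|iter r transfer (run_prob (Num.trunc t) m) (ratio w) - t ^- m * (ln 2)^-1|
  <= t ^- m * (2^-1 ^+ r +
       ((1 + t^-1) ^+ m - ((1 + 2 * t^-1)^-1) ^+ m) * ((ln 2)^-1 + 1)).
Proof.
move=> t0 m0; set a := (_^-1) ^+ m; set b := (1 + t^-1) ^+ m.
pose G : R := iter r transfer (+%R 1) (ratio w).
have t'0 : 0 < t^-1 by rewrite invr_gt0.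
have A0 : 0 < t ^- m by rewrite invr_gt0 exprn_gt0.
have a0 : 0 <= a by rewrite exprn_ge0// invr_ge0; lra.
have a1 : a <= 1.
  by rewrite exprn_ile1 ?invr_ge0 ?invf_le1; lra.
have b1 : 1 <= b by rewrite exprn_ege1//; lra.
have bR (f : R -> R) (K : R) : (forall x, 0 <= x <= 1 -> `|f x| <= K) ->
    bounded_fun_on (fun u : seq nat => f (ratio u)).
  by move=> fK; exists K => u; apply: fK; exact: ratio_itv.
have b_run : bounded_fun_on (fun u => run_prob (R := R) (Num.trunc t) m (ratio u)).
  apply: (bR _ 1) => x /andP[x0 _].
  by have /andP[h0 h1] := run_prob_itv (Num.trunc t) m x0; rewrite ger0_norm.
have b_g : bounded_fun_on (fun u : seq nat => (1 + ratio u : R)).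
  by apply: (bR _ 2) => x /andP[x0 x1]; rewrite ger0_norm; lra.
have lo : t ^- m * a * G <= iter r transfer (run_prob (Num.trunc t) m) (ratio w).
  rewrite /G -!word_mean_ratio -word_meanZ//; apply: ler_word_mean => //.
    exact: bounded_fun_onZ.
  move=> v _; have := ratio_itv (R := R) (w ++ v).
  by move=> /(run_prob_sandwich t0)/(_ m0)/andP[+ _]; rewrite mulrC.
have up : iter r transfer (run_prob (Num.trunc t) m) (ratio w) <= t ^- m * b * G.
  rewrite /G -!word_mean_ratio -word_meanZ//; apply: ler_word_mean => //.
    exact: bounded_fun_onZ.
  move=> v _; have := ratio_itv (R := R) (w ++ v).
  by move=> /(run_prob_sandwich t0)/(_ m0)/andP[_ +]; rewrite mulrC.
have := gauss_kuzmin_levy r (ratio_itv (R := R) w); rewrite -/G.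
set e := 2^-1 ^+ r; set c := (ln 2)^-1.
have e1 : e <= 1 by rewrite exprn_ile1// invf_le1// ler1n.
have e0 : 0 <= e by rewrite exprn_ge0.
have c0 : 0 <= c by rewrite invr_ge0 ln_ge0// ler1n.
move: lo up; set X := iter _ _ _ _; set A := t ^- m in A0 *.
clearbody a b G e c X A => lo up.
rewrite !ler_norml => /andP[g1 g2].
have hlo : A * (- (e + (b - a) * (c + 1))) <= A * (a * G - c).
  by apply: ler_wpM2l; [exact: ltW|nra].
have hup : A * (b * G - c) <= A * (e + (b - a) * (c + 1)).
  by apply: ler_wpM2l; [exact: ltW|nra].
by apply/andP; split; lra.
Qed.

Variables (theta : R) (m k : nat).
Hypotheses (theta_gt0 : 0 < theta) (m_gt0 : (0 < m)%N).

Definition threshold (n : nat) : R := (theta * n%:R) `^ (m%:R^-1).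

Lemma threshold_exp n : threshold n ^+ m = theta * n%:R.
Proof.
rewrite -powR_mulrn ?powR_ge0// -powRrM mulVf ?powRr1//.
  by rewrite mulr_ge0// ltW.
by rewrite pnatr_eq0 -lt0n.
Qed.

Lemma threshold_gt0 n : (0 < n)%N -> 0 < threshold n.
Proof. by move=> n0; rewrite powR_gt0// mulr_gt0// ltr0n. Qed.

Lemma cvg_threshold : (threshold n)^-1 @[n --> \oo] --> 0.
Proof.
apply/cvgr0Pnorm_le => e e0; near=> n.
have n0 : (0 < n)%N by near: n; exact: nbhs_infty_gt.
have t0 := threshold_gt0 n0.
rewrite ger0_norm ?invr_ge0 ?(ltW t0)// -[leRHS]invrK lef_pV2 ?posrE ?invr_gt0//.
rewrite leNgt; apply/negP => te.
have : threshold n ^+ m < e^-1 ^+ m.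
  by rewrite ltrXn2r ?nnegrE// ?invr_ge0 ?ltW// -?lt0n.
rewrite threshold_exp mulrC -ltr_pdivlMr//; apply/negP; rewrite -leNgt.
by near: n; exact: nbhs_infty_ger.
Unshelve. all: by end_near. Qed.

Lemma cvg_word_mean_nb_occ :
  word_mean (n + m) [::]
    (fun u => (nb_occ (Num.trunc (threshold n)) m n u == k)%:R) @[n --> \oo] -->
  (1 / (theta * ln 2) ^+ k) * (1 / (k`!)%:R) * expR (- (1 / (theta * ln 2))).
Proof.
have ln2 : 0 < ln 2 :> R by rewrite ln_gt0// ltr1n.
set lam := 1 / (theta * ln 2).
have lam0 : 0 <= lam by rewrite /lam divr_ge0// mulr_ge0// ltW.
have -> : 1 / (theta * ln 2) ^+ k = lam ^+ k by rewrite /lam !div1r exprVn.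
rewrite -[X in _ --> X]add0r.
pose B n := binom_hit (lam * n%:R^-1) k n 0.
set W := fun n => word_mean _ _ _.
suff WB : W n - B n @[n --> \oo] --> 0.
  have -> : W = (fun n => (W n - B n) + B n) by apply/funext => n; rewrite subrK.
  by apply: cvgD => //; exact: poisson_limit.
apply/cvgr0Pnorm_le => e e0.
(* The mixing time [r] is fixed before [n]: summed over [n] places, the mixing error
   [theta^-1 * 2^-1 ^+ r] is the only part that does not vanish as [n] grows. *)
have [r re] : exists r : nat, theta^-1 * 2^-1 ^+ r < e.
  have h : theta^-1 * 2^-1 ^+ r @[r --> \oo] --> theta^-1 * 0.
    apply: cvgM; first exact: cvg_cst.
    by apply: cvg_expr; rewrite ger0_norm// invf_lt1// ltr1n.
  rewrite mulr0 in h; have [r _ /(_ r (leqnn r)) hr] := cvgr_lt _ h _ e0.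
  by exists r.
(* The error of [word_mean_nb_occ] as a continuous function of [x = 1 / n] and
   [y = 1 / threshold n]: [lam * x] is the bias, [2 ^+ m * theta^-1 * x] bounds [q ^+ m], and a
   further [2 * y] accounts for one more large digit. The factor [n] in front cancels one [x]. *)
pose bnd (x y : R) : R := (r + m)%:R * ((2 ^+ m * theta^-1 + lam) * x) +
  (2 * (r + m)%:R * (2 ^+ m.+1 * theta^-1 * y + lam * 2 ^+ m * theta^-1 * x) +
   theta^-1 * (2^-1 ^+ r +
     ((1 + y) ^+ m - ((1 + 2 * y)^-1) ^+ m) * ((ln 2)^-1 + 1))).
have cB : bnd n%:R^-1 (threshold n)^-1 @[n --> \oo] --> bnd 0 0.
  have cX (f : nat -> R) (l : R) : f @ \oo --> l -> f n ^+ m @[n --> \oo] --> l ^+ m.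
    move=> fl; apply: (@continuous_cvg _ _ _ _ _ _ (fun x : R => x ^+ m)) => //.
    exact: exprn_continuous.
  have cc (c : R) : (fun=> c) @ \oo --> c by exact: cvg_cst.
  have cx := @cvg_invn R; have cy := cvg_threshold.
  apply: cvgD; first by apply: cvgM => //; apply: cvgM.
  apply: cvgD.
    by apply: cvgM => //; apply: cvgD; apply: cvgM.
  apply: cvgM => //; apply: cvgD => //; apply: cvgM => //; apply: cvgB.
    by apply: cX; apply: cvgD.
  apply: cX; apply: cvgV; first by rewrite mulr0 addr0 oner_neq0.
  by apply: cvgD => //; apply: cvgM.
have bnd0 : bnd 0 0 = theta^-1 * 2^-1 ^+ r.
  by rewrite /bnd !(mulr0, addr0, invr1, expr1n, subrr, mul0r, add0r).
rewrite -bnd0 in re.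
near=> n.
have n0 : (0 < n)%N by near: n; exact: nbhs_infty_gt.
have nR : 0 < n%:R :> R by rewrite ltr0n.
have bn : bnd n%:R^-1 (threshold n)^-1 < e by near: n; exact: (cvgr_lt _ cB _ re).
have p1 : lam * n%:R^-1 <= 1.
  by rewrite ler_pdivrMr// mul1r; near: n; exact: nbhs_infty_ger.
have p01 : 0 <= lam * n%:R^-1 <= 1 by rewrite p1 mulr_ge0.
apply: le_trans (ltW bn).
set t := threshold n; have t0 : 0 < t by exact: threshold_gt0.
have tE : t ^- m = theta^-1 * n%:R^-1 by rewrite /t threshold_exp invfM.
have mix w : `|iter r transfer (run_prob (Num.trunc t) m) (ratio w) - lam * n%:R^-1|
    <= theta^-1 * n%:R^-1 * (2^-1 ^+ r +
       ((1 + t^-1) ^+ m - ((1 + 2 * t^-1)^-1) ^+ m) * ((ln 2)^-1 + 1)).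
  have := mixing_rate r w t0 m_gt0; rewrite tE.
  suff -> : lam * n%:R^-1 = theta^-1 * n%:R^-1 * (ln 2)^-1 by [].
  by rewrite /lam invfM mul1r mulrAC.
apply: le_trans (word_mean_nb_occ m_gt0 k p01 (leqnn _) mix) _.
have /andP[_ tu] := truncn_itv (ltW t0).
set q := 2 * _^-1.
have q0 : 0 <= q by rewrite mulr_ge0.
have qt : q <= 2 * t^-1 by rewrite ler_wpM2l// lef_pV2 ?posrE// ltW.
have qm : q ^+ m <= 2 ^+ m * theta^-1 * n%:R^-1.
  rewrite -mulrA -tE -exprVn -exprMn lerXn2r ?nnegrE//.
  by rewrite mulr_ge0// invr_ge0 ltW.
have qm1 : q ^+ m.+1 <= 2 ^+ m.+1 * theta^-1 * t^-1 * n%:R^-1.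
  apply: (@le_trans _ _ (2 ^+ m * theta^-1 * n%:R^-1 * (2 * t^-1))).
    by rewrite exprSr ler_pM// exprn_ge0.
  by rewrite exprSr le_eqVlt; apply/orP; left; apply/eqP; ring.
rewrite /bnd; apply: lerD.
  by rewrite ler_wpM2l// mulrDl lerD2r.
rewrite mulrDr; apply: lerD; last first.
  rewrite mulrA [n%:R * _]mulrCA divff ?mulr1// lt0r_neq0//.
rewrite mulrCA ler_wpM2l// mulrDr; apply: lerD.
  apply: le_trans (ler_wpM2l (ltW nR) qm1) _.
  rewrite le_eqVlt; apply/orP; left; apply/eqP; field.
  by rewrite !lt0r_neq0.
apply: (@le_trans _ _ (n%:R * (lam * n%:R^-1 * (2 ^+ m * theta^-1 * n%:R^-1)))).
  by apply: ler_wpM2l; [exact: ltW|apply: ler_wpM2l => //; case/andP: p01].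
rewrite le_eqVlt; apply/orP; left; apply/eqP; field.
by rewrite !lt0r_neq0.
Unshelve. all: by end_near. Qed.

End asymptotics.

(** * Continued fraction expansions and cylinders *)

Section expansion.
Context {R : realType}.
Implicit Types (x y z : R) (a : nat) (w : seq nat).

Definition irrational01 : set R := [set x | 0 < x < 1 /\ irrational x].

Lemma irrational_shiftV x (i : int) :
  irrational x -> irrational (x^-1 - i%:~R : R).
Proof.
move=> irr [q _ qx]; apply: irr; exists ((q + i%:~R)^-1) => //.
by rewrite fmorphV rmorphD/= ratr_int qx subrK invrK.
Qed.

Lemma irrational_neq_nat x (n : nat) : irrational x -> x != n%:R.
Proof.
by move=> irr; apply/eqP => xn; apply: irr; exists n%:R => //; rewrite ratr_nat xn.
Qed.

Definition first_digit x : nat := (Num.trunc x^-1).-1.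

Definition gauss_map x : R := x^-1 - (first_digit x).+1%:R.

Lemma first_digit_spec x a : irrational01 x ->
  (first_digit x = a) <-> (0 < x^-1 - a.+1%:R < 1).
Proof.
move=> [/andP[x0 x1] irr].
have V1 : 1 < x^-1 by rewrite invf_gt1.
have tE : Num.trunc x^-1 = (first_digit x).+1.
  by rewrite /first_digit prednK// truncn_gt0 ltW.
have irrV n : x^-1 != n%:R.
  have := @irrational_neq_nat _ 0 (irrational_shiftV (i := n%:Z) irr).
  by rewrite -pmulrn subr_eq0.
split=> [<-|/andP[h1 h2]].
  have /andP[] := truncn_itv (ltW (lt_trans ltr01 V1)); rewrite tE.
  rewrite le_eqVlt eq_sym (negbTE (irrV _))/= => h1 h2.
  by rewrite subr_gt0 h1 ltrBlDl natr1.
apply/eqP; rewrite -eqSS -tE truncn_eq; last by lra.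
by apply/andP; split; rewrite -?[a.+2%:R]natr1; lra.
Qed.

Lemma gauss_map_irrational01 x : irrational01 x -> irrational01 (gauss_map x).
Proof.
move=> ix; split; first exact/(first_digit_spec _ ix).
by have := irrational_shiftV (i := (first_digit x).+1%:Z) ix.2; rewrite -pmulrn.
Qed.

Definition gauss_digit x (i : nat) : nat := first_digit (iter i gauss_map x).

Lemma gauss_digitS x i : gauss_digit x i.+1 = gauss_digit (gauss_map x) i.
Proof. by rewrite /gauss_digit iterSr. Qed.

Lemma iter_gauss_irrational01 x i :
  irrational01 x -> irrational01 (iter i gauss_map x).
Proof. by move=> ix; elim: i => //= i; exact: gauss_map_irrational01. Qed.

(** The inverse branch, along the letters [w], of the iterated Gauss map. *)
Definition cf_branch w y : R := foldr (fun a z => (a.+1%:R + z)^-1) y w.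

Lemma cf_branch_itv w y : 0 <= y <= 1 -> 0 <= cf_branch w y <= 1.
Proof.
by move=> y01; elim: w => //= a w /andP[z0 _]; exact: inv_digit_itv.
Qed.

Lemma cf_finite_branch w : cf_finite R [seq a.+1 | a <- w] = cf_branch w 0.
Proof. by elim: w => //= a w ->. Qed.

Lemma cf_branch_gauss x n : irrational01 x ->
  x = cf_branch (mkseq (gauss_digit x) n) (iter n gauss_map x).
Proof.
elim: n x => [//|n IH] x ix; rewrite /mkseq /= (iotaDl 1 0) -map_comp.
have -> : [seq (gauss_digit x \o addn 1) i | i <- iota 0 n] =
    mkseq (gauss_digit (gauss_map x)) n.
  by apply: eq_map => i; rewrite /= add1n gauss_digitS.
rewrite -iterS iterSr -IH; last exact: gauss_map_irrational01.
by rewrite /gauss_map addrC subrK invrK.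
Qed.

Definition cyl_orient w : R := cf_branch w 1 - cf_branch w 0.

(** The branch is a Moebius map whose denominator is proportional to [1 + ratio w * y]; the constant
    is normalised by [y = 1], [z = 0]. *)
Lemma cf_branch_sub w y z : 0 <= y -> 0 <= z ->
  cf_branch w y - cf_branch w z =
  cyl_orient w * ((1 + ratio w) * (y - z) / ((1 + ratio w * y) * (1 + ratio w * z))).
Proof.
rewrite /cyl_orient; elim/last_ind: w y z => [|w a IH] y z y0 z0.
  by rewrite /ratio /= !(mul0r, addr0, mul1r, subr0, invr1, mulr1).
have bE v : cf_branch (rcons w a) v = cf_branch w (a.+1%:R + v)^-1.
  by rewrite /cf_branch foldr_rcons.
rewrite !bE ratio_rcons; have s0 := ratio_ge0 (R := R) w.
have A1 : 1 <= a.+1%:R :> R by rewrite ler1n.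
move: IH s0; set D := cf_branch w 1 - cf_branch w 0; set s := ratio w.
clearbody D s => IH s0.
rewrite !IH ?invr_ge0//; [|lra..].
move: a.+1%:R A1 => A A1; field.
have sA : 0 <= s * A by rewrite mulr_ge0//; lra.
have sy : 0 <= s * y by rewrite mulr_ge0.
have sz : 0 <= s * z by rewrite mulr_ge0.
by rewrite !lt0r_neq0//; nra.
Qed.

(* The branch of [w] reverses the orientation when [size w] is odd. *)
Definition cyl_len w : R := (-1) ^+ size w * cyl_orient w.

Lemma cyl_len_nil : cyl_len [::] = 1.
Proof. by rewrite /cyl_len /cyl_orient /= expr0 mul1r subr0. Qed.

(** This identifies [digit_prob] as the proportion of a cylinder taken by each subcylinder. *)
Lemma cyl_len_rcons w a :
  cyl_len (rcons w a) = cyl_len w * digit_prob (ratio w) a.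
Proof.
rewrite /cyl_len size_rcons {1}/cyl_orient {1 2}/cf_branch !foldr_rcons.
rewrite -!/(cf_branch w _) addr0.
have s0 := ratio_ge0 (R := R) w; have A1 : 1 <= a.+1%:R :> R by rewrite ler1n.
rewrite cf_branch_sub ?invr_ge0//.
rewrite /digit_prob -[a.+2%:R]natr1 exprS.
move: (ratio w) s0 a.+1%:R A1 (cyl_orient w) => s s0 A A1 D; field.
have sA : 0 <= s * A by rewrite mulr_ge0//; lra.
by rewrite !lt0r_neq0//; nra.
Qed.

Lemma cyl_len_ge0 w : 0 <= cyl_len w.
Proof.
elim/last_ind: w => [|w a IH]; first by rewrite cyl_len_nil.
by rewrite cyl_len_rcons mulr_ge0// digit_prob_ge0// ratio_ge0.
Qed.

Lemma digit_prob_le_half (s : R) a : 0 <= s -> digit_prob s a <= 2^-1.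
Proof.
move=> s0; have a0 : 0 <= a%:R :> R by [].
rewrite /digit_prob -[a.+2%:R]natr1 -natr1 ler_pdivrMr; last by rewrite mulr_gt0; lra.
by nra.
Qed.

Lemma cyl_len_le w : cyl_len w <= 2^-1 ^+ size w.
Proof.
elim/last_ind: w => [|w a IH]; first by rewrite cyl_len_nil.
rewrite cyl_len_rcons size_rcons exprSr ler_pM ?cyl_len_ge0//.
  by rewrite digit_prob_ge0// ratio_ge0.
by rewrite digit_prob_le_half// ratio_ge0.
Qed.

Lemma cf_branch_dist w y : 0 <= y <= 1 ->
  `|cf_branch w y - cf_branch w 0| <= 2 * 2^-1 ^+ size w.
Proof.
move=> /andP[y0 y1]; rewrite cf_branch_sub// subr0 mulr0 addr0 mulr1.
have /andP[s0 s1] := ratio_itv (R := R) w.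
have lenE : `|cyl_orient w| = cyl_len w.
  by rewrite -(ger0_norm (cyl_len_ge0 w)) /cyl_len normrMsign.
rewrite normrM lenE mulrC.
apply: ler_pM; [by []|exact: cyl_len_ge0| |exact: cyl_len_le].
have sy : 0 <= ratio w * y by rewrite mulr_ge0.
rewrite ger0_norm; last by rewrite divr_ge0// ?mulr_ge0//; lra.
by rewrite ler_pdivrMr; nra.
Qed.

Lemma gauss_expansion x : irrational01 x ->
  is_cf_expansion x (fun i => (gauss_digit x i.-1).+1).
Proof.
move=> ix; split => //.
have E n : cf_finite R [seq (gauss_digit x i.-1).+1 | i <- iota 1 n] =
    cf_branch (mkseq (gauss_digit x) n) 0.
  rewrite -cf_finite_branch; congr cf_finite.
  by rewrite /mkseq -map_comp (iotaDl 1 0) -map_comp; apply: eq_map => i.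
under eq_fun do rewrite E.
have h : 2 * 2^-1 ^+ n @[n --> \oo] --> (0 : R).
  rewrite -[X in _ --> X](mulr0 2); apply: cvgM; first exact: cvg_cst.
  by apply: cvg_expr; rewrite ger0_norm// invf_lt1// ltr1n.
apply/cvgrPdist_le => e e0; near=> n.
rewrite {1}(cf_branch_gauss n ix); apply: le_trans (cf_branch_dist _ _) _.
  have [/andP[y0 y1] _] := iter_gauss_irrational01 n ix.
  by rewrite !ltW.
rewrite size_mkseq ltW//; near: n; exact: (cvgr_lt _ h).
Unshelve. all: by end_near. Qed.

Lemma cf_finite_itv (s : seq nat) : all (leq 1) s -> 0 <= cf_finite R s <= 1.
Proof.
elim: s => [|[//|b] s IH] /=; first by rewrite lexx ler01.
by move=> /IH/andP[c0 _]; exact: inv_digit_itv.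
Qed.

(** The tails of the convergents stay in [0, 1] and converge to the inverse of [x] minus the first
    digit. Irrationality excludes both ends, so that digit is the integer part. *)
Lemma expansion_step x (b : nat -> nat) : irrational01 x -> is_cf_expansion x b ->
  b 1%N = (first_digit x).+1 /\ is_cf_expansion (gauss_map x) (fun i => b i.+1).
Proof.
move=> ix [b1 bx].
have x0 : x != 0 by have [/andP[x0 _] _] := ix; rewrite lt0r_neq0.
pose c n := cf_finite R [seq b i.+1 | i <- iota 1 n].
have cE n : c n = (cf_finite R [seq b i | i <- iota 1 n.+1])^-1 - (b 1%N)%:R.
  by rewrite /c /= invrK addrC addKr (iotaDl 1 1 n) -map_comp.
have cl : c n @[n --> \oo] --> x^-1 - (b 1%N)%:R.
  under eq_fun do rewrite cE.
  apply: cvgB; last exact: cvg_cst.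
  by apply: cvgV => //;
    rewrite (cvg_shiftS (fun n => cf_finite R [seq b i | i <- iota 1 n])).
have c01 n : 0 <= c n <= 1.
  apply: cf_finite_itv; apply/allP => _ /mapP[i _ ->]; exact: b1.
have l0 : 0 <= x^-1 - (b 1%N)%:R.
  by apply: (cvgr_to_ge cl); apply: nearW => n; case/andP: (c01 n).
have l1 : x^-1 - (b 1%N)%:R <= 1.
  by apply: (cvgr_to_le cl); apply: nearW => n; case/andP: (c01 n).
have irr : irrational (x^-1 - (b 1%N)%:R).
  by have := irrational_shiftV (i := (b 1%N)%:Z) ix.2; rewrite -pmulrn.
have n0 := @irrational_neq_nat _ 0 irr; have n1 := @irrational_neq_nat _ 1 irr.
have bE : b 1%N = (first_digit x).+1.
  have b1E : b 1%N = (b 1%N).-1.+1 by rewrite prednK// b1.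
  rewrite b1E; congr S; symmetry; apply/(first_digit_spec _ ix).
  by rewrite -b1E !lt_neqAle eq_sym n0 l0 n1 l1.
split=> //; split; first by move=> i i1; exact: b1.
by rewrite /gauss_map -bE.
Qed.

Lemma expansion_unique x (b : nat -> nat) i : irrational01 x ->
  is_cf_expansion x b -> b i.+1 = (gauss_digit x i).+1.
Proof.
elim: i x b => [|i IH] x b ix bx; first by have [] := expansion_step ix bx.
have [_ bx'] := expansion_step ix bx.
by rewrite gauss_digitS -(IH _ _ (gauss_map_irrational01 ix) bx').
Qed.

Lemma cf_digit_gauss x i : irrational01 x -> cf_digit x i.+1 = (gauss_digit x i).+1.
Proof.
move=> ix; apply: expansion_unique => //; rewrite /cf_digit.
exact: (xgetI (fun=> 0%N) (gauss_expansion ix)).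
Qed.

(** Both indices and values shift by one: the digit [a.+1] exceeds [t] exactly when the letter [a]
    is at least [Num.trunc t]. *)
Lemma num_large_tuplesE m n t x : irrational01 x ->
  num_large_tuples m n t x =
  nb_occ (Num.trunc t) m n (mkseq (gauss_digit x) (n + m)).
Proof.
move=> ix; rewrite /num_large_tuples /nb_occ -sum1_count big_mkcond/=.
have -> : iota 1 n = index_iota 1 n.+1 by rewrite /index_iota subSS subn0.
rewrite big_add1/=; apply: eq_big_nat => i /andP[_ i_n].
rewrite /occ -[RHS]/(if all _ _ then 1 else 0)%N; congr (if _ then _ else _).
rewrite -[i.+1]add1n iotaDl all_map; apply: eq_in_all => j.
rewrite mem_iota => /andP[_ jim] /=.
rewrite add1n cf_digit_gauss// nth_mkseq ?truncn_le_nat//.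
by rewrite (leq_trans jim)// leq_add2r ltnW.
Qed.

End expansion.

(** * Lebesgue measure of cylinders and of digit events *)

Section cylinder_measure.
Context {R : realType}.
Implicit Types (x : R) (w : seq nat).
Local Notation mu := (@lebesgue_measure R).

(** Each letter inverts and so reverses the order; the parity of the length decides which value of
    the branch is the left end. *)
Lemma gauss_digit_cylinder x w : irrational01 x ->
  (mkseq (gauss_digit x) (size w) = w) <->
  cf_branch w (odd (size w))%:R < x < cf_branch w (~~ odd (size w))%:R.
Proof.
elim: w x => [|a w IH] x ix /=.
  by split=> // _; have [+ _] := ix.
have -> : mkseq (gauss_digit x) (size w).+1 =
    first_digit x :: mkseq (gauss_digit (gauss_map x)) (size w).
  rewrite /mkseq /= (iotaDl 1 0) -map_comp; congr cons.
  by apply: eq_map => i; rewrite /= add1n gauss_digitS.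
have itv01 (b : bool) : 0 <= (b%:R : R) <= 1 by case: b; rewrite ?lexx ?ler01.
have ig := gauss_map_irrational01 ix.
have [/andP[x0 x1] _] := ix.
rewrite negbK; have /andP[lo0 _] := cf_branch_itv w (itv01 (odd (size w))).
have /andP[hi0 hi1] := cf_branch_itv w (itv01 (~~ odd (size w))).
move: lo0 hi0 hi1 (IH _ ig).
set lo := cf_branch w (odd (size w))%:R.
set hi := cf_branch w (~~ odd (size w))%:R => lo0 hi0 hi1 {}IH.
have A1 : 1 <= a.+1%:R :> R by rewrite ler1n.
have xE : (a.+1%:R + hi)^-1 < x < (a.+1%:R + lo)^-1 <->
    lo < x^-1 - a.+1%:R < hi.
  rewrite ltrBrDl ltrBlDl -{1 2}[x]invrK !ltf_pV2 ?posrE ?invr_gt0//; [|lra..].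
  by rewrite andbC.
split=> [[dx wx]|/xE h].
  by apply/xE; move/IH: wx; rewrite /gauss_map dx.
have dx : first_digit x = a.
  by apply/(first_digit_spec _ ix); move/andP: h => [h1 h2]; apply/andP; split; lra.
by rewrite dx; congr cons; apply/IH; rewrite /gauss_map dx.
Qed.

Definition cylinder w : set R :=
  [set x | irrational01 x /\ mkseq (gauss_digit x) (size w) = w].

Lemma cylinderE w : cylinder w =
  `]cf_branch w (odd (size w))%:R, cf_branch w (~~ odd (size w))%:R[ `\` rational.
Proof.
have itv01 (b : bool) : 0 <= (b%:R : R) <= 1 by case: b; rewrite ?lexx ?ler01.
apply/seteqP; split=> x /=; rewrite in_itv/=.
  by move=> [ix /(gauss_digit_cylinder w ix)]; case: ix.
move=> [h irr].
have ix : irrational01 x.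
  split=> //; have /andP[l0 _] := cf_branch_itv w (itv01 (odd (size w))).
  have /andP[_ h1] := cf_branch_itv w (itv01 (~~ odd (size w))).
  by move/andP: h => [lx xh]; rewrite (le_lt_trans l0 lx) (lt_le_trans xh h1).
by split=> //; apply/gauss_digit_cylinder.
Qed.

Lemma measurable_rational : measurable (rational : set R).
Proof.
apply: countable_measurable; first exact: measurable_set1.
apply: card_le_trans (card_image_le _ _) _; exact: countableP.
Qed.

Lemma measurable_cylinder w : measurable (cylinder w).
Proof. by rewrite cylinderE; apply: measurableD => //; exact: measurable_rational. Qed.

Lemma lebesgue_cylinder w : mu (cylinder w) = (cyl_len w)%:E.
Proof.
have lenE : cyl_len w =
    cf_branch w (~~ odd (size w))%:R - cf_branch w (odd (size w))%:R :> R.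
  rewrite /cyl_len /cyl_orient -signr_odd.
  by case: (odd _); rewrite /= ?expr0 ?expr1; lra.
rewrite cylinderE; set I := `]_, _[%classic.
have muI : mu I = (cyl_len w)%:E.
  rewrite /I lebesgue_measure_itv/= lte_fin lenE.
  case: ltP => [_|h]; first by rewrite EFinB.
  by have := @cyl_len_ge0 R w; rewrite lenE => h'; congr EFin; lra.
have mI : measurable I by exact: measurable_itv.
have IQ0 : mu (I `&` rational) = 0%E.
  apply: (@subset_measure0 _ _ _ mu _ rational).
  - by apply: measurableI => //; exact: measurable_rational.
  - exact: measurable_rational.
  - exact: subIsetr.
  - exact: lebesgue_measure_rat.
transitivity (mu I - mu (I `&` rational))%E; last by rewrite muI IQ0 sube0.
apply: measureD => //; first exact: measurable_rational.
by rewrite [ltLHS]muI ltry.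
Qed.

Definition digit_event (F : seq nat -> bool) (N : nat) w : set R :=
  [set x | cylinder w x /\ F (mkseq (gauss_digit x) (size w + N))].

Lemma digit_eventS F N w : digit_event F N.+1 w =
  \bigcup_a digit_event F N (rcons w a).
Proof.
apply/seteqP; split=> x.
  move=> [[ix wx] Fx]; exists (gauss_digit x (size w)) => //.
  split; last by rewrite size_rcons addSnnS.
  by split=> //; rewrite size_rcons mkseqS wx.
move=> [a _ [[ix wx] Fx]]; rewrite size_rcons in wx Fx.
split; last by rewrite -addSnnS.
by split=> //; move: wx; rewrite mkseqS => /rcons_inj[].
Qed.

(** Splitting by the next letter and countable additivity reproduce the series of [digit_mean], so
    word expectations are Lebesgue measures relative to the cylinder. *)
Lemma lebesgue_digit_event F N w : measurable (digit_event F N w) /\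
  mu (digit_event F N w) = (cyl_len w * word_mean N w (fun u => (F u)%:R))%:E.
Proof.
elim: N w => [|N IH] w.
  have -> : digit_event F 0 w = if F w then cylinder w else set0.
    apply/seteqP; split=> x.
      by move=> [[ix wx]]; rewrite addn0 wx => ->.
    case: ifP => // Fw [ix wx]; split=> //.
    by rewrite addn0 wx.
  case: ifP => Fw /=; rewrite Fw.
    by rewrite mulr1; split; [exact: measurable_cylinder|exact: lebesgue_cylinder].
  by rewrite mulr0; split; [exact: measurable0|exact: measure0].
rewrite digit_eventS; have mE a := (IH (rcons w a)).1; split.
  by apply: bigcup_measurable => a _; exact: mE.
rewrite measure_semi_bigcup//; first last.
- by apply: bigcup_measurable => a _; exact: mE.
- apply/trivIsetP => a b _ _ ab; apply/seteqP; split=> // x.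
  move=> [[[_ wa] _] [[_ wb] _]]; move: wa wb; rewrite !size_rcons => ->.
  by move=> /rcons_inj[/eqP]; rewrite (negbTE ab).
set f := fun a => word_mean N (rcons w a) (fun u => (F u)%:R : R).
have bf : bounded_fun_on f by apply: bounded_word_mean; exact: bounded_fun_on_bool.
have s0 := ratio_ge0 (R := R) w.
apply: cvg_lim => //.
have -> : (fun n => \sum_(0 <= a < n) mu (digit_event F N (rcons w a)))%E =
    EFin \o (fun n => cyl_len w * series (fun a => digit_prob (ratio w) a * f a) n).
  apply/funext => n /=; rewrite /series/= mulr_sumr -sumEFin.
  by apply: eq_bigr => a _; rewrite (IH _).2 cyl_len_rcons mulrA.
apply: cvg_EFin; first exact: nearW.
apply: cvgM; first exact: cvg_cst.
exact: cvg_digit_mean.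
Qed.

End cylinder_measure.

Theorem corollary4p6 (R : realType) (theta : R) (htheta : 0 < theta)
    (m k : nat) (hm : (1 <= m)%N) :
  lebesgue_measure
    [set x : R | 0 < x < 1 /\ irrational x /\
       num_large_tuples m n ((theta * n%:R) `^ (m%:R^-1)) x = k]
    @[n --> \oo] -->
  ((1 / (theta * ln 2) ^+ k) * (1 / (k`!)%:R)
     * expR (- (1 / (theta * ln 2))))%:E.
Proof.
(* The event depends on the first [n + m] digits only, and the cylinder of the empty word is the set
   of all irrationals of (0, 1), of length 1. *)
have -> : (fun n => lebesgue_measure [set x : R | 0 < x < 1 /\ irrational x /\
      num_large_tuples m n ((theta * n%:R) `^ (m%:R^-1)) x = k]) =
    EFin \o (fun n => word_mean (n + m) [::]
      (fun u => (nb_occ (Num.trunc (threshold theta m n)) m n u == k)%:R)).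
  apply/funext => n /=.
  have [_] := lebesgue_digit_event (R := R)
    (fun u => nb_occ (Num.trunc (threshold theta m n)) m n u == k) (n + m) [::].
  rewrite cyl_len_nil mul1r => <-; congr lebesgue_measure.
  apply/seteqP; split=> x /=.
    move=> [x01 [irr xk]]; have ix : irrational01 x by [].
    by split; [split|rewrite add0n -num_large_tuplesE//; apply/eqP].
  move=> [[ix _]]; rewrite add0n -num_large_tuplesE// => /eqP xk.
  by case: ix.
apply: cvg_EFin; first exact: nearW.
exact: cvg_word_mean_nb_occ.
Qed.
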